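(* Let $d\ge 1$ and $0<\mu<4d$. There exist a finite length $L_\#(\mu)$ and a finite coupling constant $U_\#(\mu)\ge 0$ such that for all even integers $L\ge L_\#(\mu)$ and all $U\ge U_\#(\mu)$ the minimal HFz energy on $\Lambda=\mathbb{Z}_L^d$ equals the sum of the negative eigenvalues of $-\Delta-\mu$: $$E^{(\mathrm{hfz})}_{\mu,U}=\mathrm{Tr}\{[-\Delta-\mu]_-\}.$$ Moreover, if $\mu$ is not an eigenvalue of $-\Delta$ and $(\gamma_\uparrow,\gamma_\downarrow)$ is a minimizer of the HFz functional (i.e. $0\le\gamma_{\uparrow},\gamma_\downarrow\le 1$ and $\mathcal{E}^{(\mathrm{hfz})}_{\mu,U}(\gamma_\uparrow,\gamma_\downarrow)=E^{(\mathrm{hfz})}_{\mu,U}$), then either $\gamma_\uparrow=\mathbb{1}[-\Delta<\mu]$ and $\gamma_\downarrow=0$, or $\gamma_\uparrow=0$ and $\gamma_\downarrow=\mathbb{1}[-\Delta<\mu]$, where $\mathbb{1}[-\Delta<\mu]$ is the spectral projection of $-\Delta$ onto $(-\infty,\mu)$.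
   Context: $\Lambda=\mathbb{Z}_L^d=(\mathbb{Z}/L\mathbb{Z})^d$ is the periodic cubic lattice with $L$ even. For $x,y\in\Lambda$, $|x-y|_1$ is the (periodic) $\ell^1$ lattice distance. The nearest-neighbour hopping matrix is $T_{x,y}=1$ if $|x-y|_1=1$ and $0$ otherwise; the discrete Laplacian is $\Delta_{x,y}=T_{x,y}-2d\,\delta_{x,y}$ (so $-\Delta\ge 0$). Set $K_\mu=-\Delta-\mu$. For a self-adjoint matrix $X$, $[X]_-=\min\{X,0\}$ (negative part, a nonpositive matrix), so $\mathrm{Tr}[X]_-$ is the sum of the negative eigenvalues of $X$; $\mathrm{Tr}$ is the trace on $\mathbb{C}^\Lambda$. A one-particle density matrix is a Hermitian $\Lambda\times\Lambda$ matrix $\gamma$ with $0\le\gamma\le1$. The HFz functional is $\mathcal{E}^{(\mathrm{hfz})}_{\mu,U}(\gamma_\uparrow,\gamma_\downarrow)=\mathrm{Tr}\{K_\mu(\gamma_\uparrow+\gamma_\downarrow)\}+U\sum_{x\in\Lambda}\rho_\uparrow(x)\rho_\downarrow(x)$, with $\rho_\sigma(x)=(\gamma_\sigma)_{x,x}$, and $E^{(\mathrm{hfz})}_{\mu,U}=\min\{\mathcal{E}^{(\mathrm{hfz})}_{\mu,U}(\gamma_\uparrow,\gamma_\downarrow): 0\le\gamma_\uparrow,\gamma_\downarrow\le1\}$. *)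

(* Defs.v *)
From HB Require Import structures.
From mathcomp Require Import all_boot all_order all_algebra.
From mathcomp Require Import classical_sets reals.
From mathcomp.real_closed Require Import polyrcf complex.
Unset Printing Implicit Defensive.
Import Order.TTheory GRing.Theory Num.Theory.
Local Open Scope ring_scope.

Definition lattice (d L : nat) : finType := {ffun 'I_d -> 'I_L}.

Definition cdist (L : nat) (a b : 'I_L) : nat :=
  let t := ((a - b) + (b - a))%N in minn t (L - t).

Definition l1dist (d L : nat) (x y : lattice d L) : nat :=
  (\sum_(i < d) cdist L (x i) (y i))%N.

Definition nsites (d L : nat) : nat := #|lattice d L|.

(* matrices on C^Λ are indexed through the enumeration of Λ *)
Definition site (d L : nat) (i : 'I_(nsites d L)) : lattice d L := enum_val i.

Definition hopping (R : realType) (d L : nat) : 'M[R]_(nsites d L) :=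
  \matrix_(i, j) (if l1dist d L (site d L i) (site d L j) == 1%N then 1 else 0).

Definition laplacian (R : realType) (d L : nat) : 'M[R]_(nsites d L) :=
  hopping R d L - (2 * d)%:R%:M.

Definition Kmu (R : realType) (d L : nat) (mu : R) : 'M[R]_(nsites d L) :=
  - laplacian R d L - mu%:M.

Definition cplx {R : realType} {n} (A : 'M[R]_n) : 'M[R[i]]_n :=
  map_mx (fun x : R => real_complex R x) A.

Definition adjmx {R : realType} {m n} (A : 'M[R[i]]_(m, n)) : 'M[R[i]]_(n, m) :=
  (map_mx Num.conj A)^T.

Definition hermitian {R : realType} {n} (A : 'M[R[i]]_n) : Prop := adjmx A = A.

Definition psd {R : realType} {n} (A : 'M[R[i]]_n) : Prop :=
  hermitian A /\ forall v : 'cV[R[i]]_n, 0 <= (adjmx v *m A *m v) 0 0.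

Definition density_matrix {R : realType} {n} (g : 'M[R[i]]_n) : Prop :=
  psd g /\ psd (1%:M - g).

Definition trace_neg {R : realType} {n} (X : 'M[R]_n) : R :=
  \sum_(r <- rootsR (char_poly X) | r < 0) r *+ mup r (char_poly X).

(* HFz functional (real-valued; the complex expression is real for
   Hermitian arguments, we take its real part) *)
Definition hfz_energy {R : realType} (d L : nat) (mu U : R)
    (gu gd : 'M[R[i]]_(nsites d L)) : R :=
  complex.Re (\tr (cplx (Kmu R d L mu) *m (gu + gd))
      + real_complex R U * \sum_(x < nsites d L) gu x x * gd x x).

Definition hfz_min_energy {R : realType} (d L : nat) (mu U : R) : R :=
  inf [set e | exists gu gd, density_matrix gu /\ density_matrix gd /\
                             e = hfz_energy d L mu U gu gd].

Definition is_orth_proj {R : realType} {n} (P S : 'M[R[i]]_n) : Prop :=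
  hermitian P /\ P *m P = P /\ (P == S)%MS.

Definition low_spectral_subspace {R : realType} (d L : nat) (mu : R)
    : 'M[R[i]]_(nsites d L) :=
  (\sum_(a <- rootsR (char_poly (- laplacian R d L)) | (a < mu)%R)
      eigenspace (cplx (- laplacian R d L)) (real_complex R a))%MS.

Definition spectral_proj_below {R : realType} (d L : nat) (mu : R)
    (P : 'M[R[i]]_(nsites d L)) : Prop :=
  is_orth_proj P (low_spectral_subspace d L mu).

(* Main.v *)
Require Import Defs.
From HB Require Import structures.
From mathcomp Require Import all_boot all_order all_algebra.
From mathcomp Require Import classical_sets reals.
From mathcomp.real_closed Require Import polyrcf complex.
From mathcomp Require Import perm ring lra zify.
Import Order.TTheory GRing.Theory Num.Theory.
Local Open Scope ring_scope.

(**
Since a sum of two density matrices with complementary supports is again at most 1, two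
non-overlapping spin densities have energy at least Tr [K]_-; for finite U the overlap has to be
paid for by a local gain. Let P be the spectral projection of K onto negative energies and
D = gu + gd - P. Diagonalizing K, one has
  Tr K (gu + gd) - Tr [K]_-  >=  1/2 Tr D |K| D + Tr [K]_- (gu gd + gd gu),
and the last term only involves sites where both densities are nonzero. Call a site bad
if the local gain <D e_x, |K| D e_x> or the local interaction U ru(x) rd(x) exceeds a fixed delta.
At a good site the column D e_x is small entrywise, because the density of states of K near 0 is
small uniformly in L; as P has diagonal entries and nearest-neighbour entries bounded below
uniformly in L, a good site has a definite majority spin, and neighbouring good sites have the
same one. Cutting the minority spin off at good sites costs only hopping between good and bad
sites, which is O(1/U) per bad site, while it removes an interaction of order U per unit of
minority density. Hence
  E - Tr [K]_-  >=  c1 #bad + c2 (minority density),   c1, c2 > 0,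
for U large. Equality forces all sites to be good, so one spin is absent by connectedness and the
other density matrix is P.
*)

Local Notation Re := complex.Re.
Local Notation Im := complex.Im.
Local Notation rc := (real_complex _).

(** * Scalars and density matrices *)

(** The difficulty is uniformity in L: eigenvalues of K may accumulate at 0 as L grows, and the
    gain, being weighted by |K|, says little about the part of D carried by them. That part is
    handled by the local density of states. Both uniform inputs, the lower bounds on P and the
    smallness of the density of states, come from symmetry instead of explicit plane waves.
    Translations and axis exchanges commute with K, so every function of K has constant diagonal and
    constant nearest-neighbour entries. A local bound then reduces to a trial function on a fixed
    finite box, or to counting eigenvalues. Constants are fixed in this order, none depending on L:
    [p] from d and t = 2d - mu (where |t| < 2d is exactly 0 < mu < 4d), [eps] = p^4/160, [eta] from
    the density of states, [delta] = eta p^4/16, and last the threshold on the coupling. Evenness of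
    L enters for mu > 2d, where the trial function carries the sublattice sign. *)

Definition sq {R : realType} (z : R[i]) : R := Re z ^+ 2 + Im z ^+ 2.

Lemma ReD {R : realType} (x y : R[i]) : Re (x + y) = Re x + Re y.
Proof. by case: x; case: y. Qed.
Lemma ReN {R : realType} (x : R[i]) : Re (- x) = - Re x.
Proof. by case: x. Qed.
Lemma ReB {R : realType} (x y : R[i]) : Re (x - y) = Re x - Re y.
Proof. by rewrite ReD ReN. Qed.
Lemma ReZ {R : realType} (a : R) (z : R[i]) : Re (rc a * z) = a * Re z.
Proof. by case: z => x y /=; rewrite mul0r subr0. Qed.
Lemma Re_conj {R : realType} (z : R[i]) : Re (Num.conj z) = Re z.
Proof. by case: z. Qed.
Lemma Re_sum {R : realType} (I : Type) (r : seq I) (P : pred I) (F : I -> R[i]) :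
  Re (\sum_(i <- r | P i) F i) = \sum_(i <- r | P i) Re (F i).
Proof. by apply: big_morph; [exact: ReD|]. Qed.
Lemma conj_rc {R : realType} (a : R) : Num.conj (rc a) = rc a.
Proof. by rewrite /Num.conj /=; apply/eqP; rewrite eq_complex /= oppr0 !eqxx. Qed.

Lemma sq_ge0 {R : realType} (z : R[i]) : 0 <= sq z.
Proof. by rewrite addr_ge0 ?sqr_ge0. Qed.
Lemma sqE {R : realType} (z : R[i]) : rc (sq z) = Num.conj z * z.
Proof. by case: z => x y; apply/eqP; rewrite eq_complex /sq /=; apply/andP; split; apply/eqP; ring. Qed.
Lemma Re_mul_conj {R : realType} (z : R[i]) : Re (z * Num.conj z) = sq z.
Proof. by rewrite mulrC -sqE. Qed.
Lemma sqM {R : realType} (x y : R[i]) : sq (x * y) = sq x * sq y.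
Proof. by case: x => a b; case: y => c e; rewrite /sq /=; ring. Qed.
Lemma sq_conj {R : realType} (x : R[i]) : sq (Num.conj x) = sq x.
Proof. by case: x => a b; rewrite /sq /=; ring. Qed.
Lemma sq_rc {R : realType} (a : R) : sq (rc a) = a ^+ 2.
Proof. by rewrite /sq /=; ring. Qed.
Lemma sq_eq0 {R : realType} (z : R[i]) : sq z = 0 -> z = 0.
Proof.
case: z => a b; rewrite /sq /= => h.
have ha : a ^+ 2 = 0 by have := sqr_ge0 a; have := sqr_ge0 b; lra.
have hb : b ^+ 2 = 0 by lra.
by apply/eqP; rewrite eq_complex /=; move/eqP: ha; move/eqP: hb; rewrite !sqrf_eq0 => -> ->.
Qed.
Lemma sq0 {R : realType} : sq (0 : R[i]) = 0.
Proof. by rewrite /sq /=; ring. Qed.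
Lemma Re_sq {R : realType} (z : R[i]) : Re z ^+ 2 <= sq z.
Proof. by rewrite /sq lerDl sqr_ge0. Qed.
Lemma sqD {R : realType} (x y : R[i]) : sq (x + y) <= 2 * sq x + 2 * sq y.
Proof.
case: x => a b; case: y => c e; rewrite /sq /=.
have := sqr_ge0 (a - c); have := sqr_ge0 (b - e); lra.
Qed.
Lemma sqN {R : realType} (x : R[i]) : sq (- x) = sq x.
Proof. by case: x => a b; rewrite /sq /=; ring. Qed.

Lemma cauchy_schwarz {R : realType} (I : finType) (Q : pred I) (a b : I -> R[i]) :
  sq (\sum_(i | Q i) a i * b i) <= (\sum_(i | Q i) sq (a i)) * (\sum_(i | Q i) sq (b i)).
Proof.
set Z := \sum_(i | Q i) a i * b i; set A := \sum_(i | Q i) sq (a i); set B := \sum_(i | Q i) sq (b i).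
have B0 : 0 <= B by apply: sumr_ge0 => i _; exact: sq_ge0.
have [Bz|Bn] := eqVneq B 0.
  have bz i : Q i -> b i = 0.
    move=> Qi; apply: sq_eq0; move/eqP: Bz; rewrite psumr_eq0; last by move=> j _; exact: sq_ge0.
    by move=> /allP /(_ i); rewrite mem_index_enum Qi => /(_ isT) /eqP.
  have -> : Z = 0 by apply: big1 => i Qi; rewrite bz // mulr0.
  by rewrite sq0 Bz mulr0.
(* Summed over [i], these squares give [B * (A * B - sq Z)], which is therefore nonnegative. *)
have h i : sq (rc B * a i - Num.conj (b i) * Z) =
   B ^+ 2 * sq (a i) - 2 * B * Re (a i * b i * Num.conj Z) + sq (b i) * sq Z.
  by case: (a i) => a1 a2; case: (b i) => b1 b2; case: (Z) => z1 z2; rewrite /sq /=; ring.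
have : 0 <= \sum_(i | Q i) sq (rc B * a i - Num.conj (b i) * Z).
  by apply: sumr_ge0 => i _; exact: sq_ge0.
rewrite (eq_bigr _ (fun i _ => h i)) big_split /= -mulr_suml sumrB -!mulr_sumr.
rewrite -/A -/B -Re_sum -mulr_suml -/Z Re_mul_conj => h2.
have {}h2 : 0 <= B * (A * B - sq Z) by move: h2; congr (_ <= _); ring.
have Bp : 0 < B by rewrite lt_def Bn.
by move: h2; rewrite pmulr_rge0 // subr_ge0.
Qed.

Lemma adjmxE {R : realType} {m n} (A : 'M[R[i]]_(m, n)) i j : adjmx A i j = Num.conj (A j i).
Proof. by rewrite !mxE. Qed.
Lemma adjmxK {R : realType} {m n} (A : 'M[R[i]]_(m, n)) : adjmx (adjmx A) = A.
Proof. by apply/matrixP => i j; rewrite !adjmxE conjCK. Qed.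
Lemma adjmxM {R : realType} {m n p} (A : 'M[R[i]]_(m, n)) (B : 'M[R[i]]_(n, p)) :
  adjmx (A *m B) = adjmx B *m adjmx A.
Proof. by rewrite /adjmx map_mxM trmx_mul. Qed.
Lemma adjmxD {R : realType} {m n} (A B : 'M[R[i]]_(m, n)) : adjmx (A + B) = adjmx A + adjmx B.
Proof. by apply/matrixP => i j; rewrite !mxE rmorphD. Qed.
Lemma adjmxN {R : realType} {m n} (A : 'M[R[i]]_(m, n)) : adjmx (- A) = - adjmx A.
Proof. by apply/matrixP => i j; rewrite !mxE rmorphN. Qed.
Lemma adjmx1 {R : realType} {n} : adjmx (1%:M : 'M[R[i]]_n) = 1%:M.
Proof. by apply/matrixP => i j; rewrite !mxE rmorph_nat eq_sym. Qed.
Lemma adjmx0 {R : realType} {m n} : adjmx (0 : 'M[R[i]]_(m, n)) = 0.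
Proof. by apply/matrixP => i j; rewrite !mxE rmorph0. Qed.

Lemma psd0 {R : realType} {n} : psd (0 : 'M[R[i]]_n).
Proof. by split=> [|v]; [exact: adjmx0|rewrite mulmx0 mul0mx mxE]. Qed.
Lemma psdD {R : realType} {n} (X Y : 'M[R[i]]_n) : psd X -> psd Y -> psd (X + Y).
Proof.
move=> [hX pX] [hY pY]; split=> [|v]; first by rewrite /Defs.hermitian adjmxD hX hY.
by rewrite mulmxDr mulmxDl mxE addr_ge0.
Qed.
Lemma psd_congr {R : realType} {m n} (X : 'M[R[i]]_n) (S : 'M[R[i]]_(n, m)) :
  psd X -> psd (adjmx S *m X *m S).
Proof.
move=> [hX pX]; split=> [|v]; first by rewrite /Defs.hermitian !adjmxM adjmxK hX mulmxA.
by have := pX (S *m v); rewrite adjmxM !mulmxA.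
Qed.
Lemma psd1 {R : realType} {n} : psd (1%:M : 'M[R[i]]_n).
Proof.
split=> [|v]; first exact: adjmx1.
rewrite mulmx1 mxE sumr_ge0 // => i _.
by rewrite adjmxE mulrC mul_conjC_ge0.
Qed.
Lemma psd_diag {R : realType} {n} (X : 'M[R[i]]_n) k : psd X -> 0 <= Re (X k k).
Proof.
move=> [_ /(_ (delta_mx k 0))].
have -> : adjmx (delta_mx k 0 : 'cV[R[i]]_n) = delta_mx 0 k.
  by apply/matrixP => i j; rewrite !mxE rmorph_nat andbC.
by rewrite -rowE -colE !mxE lecE => /andP[].
Qed.
Lemma density0 {R : realType} {n} : density_matrix (0 : 'M[R[i]]_n).
Proof. by split; [exact: psd0|rewrite subr0; exact: psd1]. Qed.

(** The identity g - g^2 = (1-g) g (1-g) + g (1-g) g exhibits the matrix as a sum of two congruences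
    of positive matrices. *)
Lemma density_sub_sq {R : realType} {n} (g : 'M[R[i]]_n) :
  density_matrix g -> psd (g - g *m g).
Proof.
move=> [pg p1].
have -> : g - g *m g = adjmx (1%:M - g) *m g *m (1%:M - g) + adjmx g *m (1%:M - g) *m g.
  rewrite p1.1 pg.1 !(mulmxBl, mulmxBr, mul1mx, mulmx1).
  by rewrite subrK.
by apply: psdD; apply: psd_congr.
Qed.

Lemma herm_entry {R : realType} {n} (g : 'M[R[i]]_n) x y : Defs.hermitian g -> g x y = Num.conj (g y x).
Proof. by move=> h; rewrite -{1}h adjmxE. Qed.

(** The left side is the diagonal entry of g^2 at [x], and g^2 <= g. *)
Lemma density_col_bound {R : realType} {n} (g : 'M[R[i]]_n) x :
  density_matrix g -> \sum_y sq (g y x) <= Re (g x x).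
Proof.
move=> dg; have := psd_diag _ x (density_sub_sq _ dg).
rewrite !mxE ReB subr_ge0 Re_sum => h; apply: le_trans h; rewrite le_eqVlt; apply/orP; left; apply/eqP.
by apply: eq_bigr => y _; rewrite (herm_entry g x y dg.1.1) -sqE.
Qed.

Lemma density_entry_bound {R : realType} {n} (g : 'M[R[i]]_n) x y :
  density_matrix g -> sq (g y x) <= Re (g x x).
Proof.
move=> /density_col_bound h; apply: le_trans (h x).
by rewrite (bigD1 y) //= lerDl sumr_ge0 // => j _; exact: sq_ge0.
Qed.

Lemma density_diag_le1 {R : realType} {n} (g : 'M[R[i]]_n) x :
  density_matrix g -> Re (g x x) <= 1.
Proof. by move=> [_ h]; have := psd_diag _ x h; rewrite !mxE eqxx ReB subr_ge0. Qed.

(** Positivity on the vector s e_x - e_y, divided by [s]. The free weight later becomes [kappa],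
    which trades minority density against the number of bad neighbours. *)
Lemma psd_offdiag {R : realType} {n} (g : 'M[R[i]]_n) x y (s : R) :
  psd g -> 0 < s -> 2 * Re (g x y) <= s * Re (g x x) + Re (g y y) / s.
Proof.
move=> pg s0.
pose S : 'M[R[i]]_(n, 1) := rc s *: delta_mx x 0 - delta_mx y 0.
have := psd_diag _ 0 (psd_congr _ S pg).
have -> : adjmx S = rc s *: delta_mx 0 x - delta_mx 0 y.
  by apply/matrixP => i j; rewrite !mxE rmorphB rmorphM !rmorph_nat /= conj_rc ![(j == _) && _]andbC.
rewrite !(mulmxBl, mulmxBr) -!scalemxAl -!scalemxAr -!rowE -!colE !mxE.
have -> : g y x = Num.conj (g x y) by exact: herm_entry pg.1.
rewrite !(ReB, ReZ, Re_conj) => h.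
have : 0 <= (s * Re (g x x) + Re (g y y) / s - 2 * Re (g x y)) by
  rewrite -(pmulr_rge0 _ s0); move: h; congr (_ <= _); field; rewrite gt_eqF.
by rewrite subr_ge0.
Qed.

(** * Functions of a diagonalized matrix *)

Definition unitary {R : realType} {n} (V : 'M[R[i]]_n) := adjmx V *m V = 1%:M /\ V *m adjmx V = 1%:M.
(* The rows of [V] are the eigenvectors, the values of [f] the eigenvalues. *)
Definition specf {R : realType} {n} (V : 'M[R[i]]_n) (f : 'I_n -> R) : 'M[R[i]]_n :=
  adjmx V *m diag_mx (\row_k rc (f k)) *m V.

Lemma exists_specf {R : realType} {n} (A : 'M[R]_n) : A^T = A ->
  exists V a, unitary V /\ cplx A = specf V a.
Proof.
move=> sA.
have hA : cplx A \is hermsymmx.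
  apply/is_hermitianmxP; rewrite expr0 scale1r; apply/matrixP => i j.
  by rewrite !mxE conj_rc -{1}sA mxE.
have rD := spectral.hermitian_spectral_diag_real hA.
have /spectral.hermitian_normalmx /spectral.orthomx_spectralP eA := hA.
have uV := spectral.spectral_unitarymx (cplx A).
have iV := spectral.invmx_unitary uV.
have adjE : adjmx (spectral.spectralmx (cplx A)) = invmx (spectral.spectralmx (cplx A)).
  by rewrite iV /adjmx map_trmx.
exists (spectral.spectralmx (cplx A)), (fun k => Re (spectral.spectral_diag (cplx A) 0 k)).
split; first split.
- by rewrite adjE mulVmx // spectral.spectral_unit.
- by rewrite adjE mulmxV // spectral.spectral_unit.
rewrite /specf adjE {1}eA; congr (_ *m diag_mx _ *m _).
apply/rowP => k; rewrite !mxE; move/mxOverP/(_ 0 k): rD => h.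
by rewrite -[LHS]RRe_real.
Qed.

Lemma specfE {R : realType} {n} (V : 'M[R[i]]_n) f x y :
  specf V f x y = \sum_k rc (f k) * (Num.conj (V k x) * V k y).
Proof. by rewrite mxE; apply: eq_bigr => k _; rewrite mul_mx_diag !mxE mulrAC mulrC mulrA. Qed.

Lemma specf_diag {R : realType} {n} (V : 'M[R[i]]_n) f x :
  Re (specf V f x x) = \sum_k f k * sq (V k x).
Proof. by rewrite specfE Re_sum; apply: eq_bigr => k _; rewrite ReZ -sqE. Qed.

Lemma specf_herm {R : realType} {n} (V : 'M[R[i]]_n) f : Defs.hermitian (specf V f).
Proof.
apply/matrixP => x y; rewrite adjmxE !specfE rmorph_sum /=.
by apply: eq_bigr => k _; rewrite !rmorphM /= conj_rc conjCK [V k y * _]mulrC.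
Qed.

Lemma specfM {R : realType} {n} (V : 'M[R[i]]_n) f h : unitary V ->
  specf V f *m specf V h = specf V (fun k => f k * h k).
Proof.
move=> [_ u]; rewrite /specf !mulmxA -[_ *m V *m adjmx V]mulmxA u mulmx1.
rewrite -[_ *m diag_mx _ *m diag_mx _]mulmxA; congr (_ *m _ *m _).
by apply/matrixP => i j; rewrite mul_diag_mx !mxE; case: eqVneq => [->|_]; rewrite ?mulr1n ?mulr0n ?mulr0 // rmorphM.
Qed.

Lemma eq_specf {R : realType} {n} (V : 'M[R[i]]_n) f h : f =1 h -> specf V f = specf V h.
Proof. by move=> e; apply/matrixP => x y; rewrite !specfE; apply: eq_bigr => k _; rewrite e. Qed.

Lemma specfD {R : realType} {n} (V : 'M[R[i]]_n) f h :
  specf V f + specf V h = specf V (fun k => f k + h k).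
Proof. by apply/matrixP => x y; rewrite mxE !specfE -big_split /=; apply: eq_bigr => k _; rewrite rmorphD mulrDl. Qed.

Lemma specf_cst {R : realType} {n} (V : 'M[R[i]]_n) (a : R) : unitary V ->
  specf V (fun=> a) = (rc a)%:M.
Proof.
move=> [u _]; rewrite /specf.
have -> : diag_mx (\row_(k < n) rc a) = (rc a)%:M :> 'M[R[i]]_n.
  by apply/matrixP => i j; rewrite !mxE.
by rewrite mul_mx_scalar -scalemxAl u scalemx1.
Qed.

Lemma specf_mulV {R : realType} {n} (V : 'M[R[i]]_n) f k x : unitary V ->
  (V *m specf V f) k x = rc (f k) * V k x.
Proof. by move=> [_ u]; rewrite /specf !mulmxA u mul1mx mul_diag_mx !mxE. Qed.

(** The expectation of [X] in the k-th eigenvector; for a density matrix, the occupation number of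
    that eigenstate. *)
Definition wt {R : realType} {n} (V X : 'M[R[i]]_n) (k : 'I_n) : R := Re ((V *m X *m adjmx V) k k).

Lemma wtD {R : realType} {n} (V X Y : 'M[R[i]]_n) k : wt V (X + Y) k = wt V X k + wt V Y k.
Proof. by rewrite /wt mulmxDr mulmxDl mxE ReD. Qed.
Lemma wtN {R : realType} {n} (V X : 'M[R[i]]_n) k : wt V (- X) k = - wt V X k.
Proof. by rewrite /wt mulmxN mulNmx mxE ReN. Qed.
Lemma wt_ge0 {R : realType} {n} (V X : 'M[R[i]]_n) k : psd X -> 0 <= wt V X k.
Proof. by move=> pX; have := psd_diag _ k (psd_congr _ (adjmx V) pX); rewrite adjmxK. Qed.
Lemma wt1 {R : realType} {n} (V : 'M[R[i]]_n) k : unitary V -> wt V 1%:M k = 1.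
Proof. by move=> [_ u]; rewrite /wt mulmx1 u mxE eqxx. Qed.

Lemma tr_specf {R : realType} {n} (V X : 'M[R[i]]_n) f :
  Re (\tr (specf V f *m X)) = \sum_k f k * wt V X k.
Proof.
rewrite /specf -!mulmxA mxtrace_mulC -!mulmxA mul_diag_mx /mxtrace Re_sum.
by apply: eq_bigr => k _; rewrite mxE [X in X * _]mxE ReZ /wt mulmxA.
Qed.

Lemma wt_mul {R : realType} {n} (V X Y : 'M[R[i]]_n) k : Defs.hermitian Y ->
  wt V (X *m Y) k = \sum_x Re ((V *m X) k x * Num.conj ((V *m Y) k x)).
Proof.
move=> hY; rewrite /wt mulmxA -mulmxA -{1}hY -adjmxM mxE Re_sum.
by apply: eq_bigr => x _; rewrite adjmxE.
Qed.

Lemma wt_sqr {R : realType} {n} (V X : 'M[R[i]]_n) k : Defs.hermitian X ->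
  wt V (X *m X) k = \sum_x sq ((V *m X) k x).
Proof. by move=> hX; rewrite wt_mul //; apply: eq_bigr => x _; rewrite Re_mul_conj. Qed.

Lemma parseval {R : realType} {n} (V : 'M[R[i]]_n) m (X : 'M[R[i]]_(n, m)) x : unitary V ->
  \sum_k sq ((V *m X) k x) = \sum_y sq (X y x).
Proof.
move=> [u _].
have e p (Y : 'M[R[i]]_(p, m)) : \sum_k sq (Y k x) = Re ((adjmx Y *m Y) x x).
  by rewrite mxE Re_sum; apply: eq_bigr => k _; rewrite adjmxE -sqE.
by rewrite !e adjmxM -mulmxA [adjmx V *m _]mulmxA u mul1mx.
Qed.

(** In the eigenbasis, commuting with the diagonal matrix of [l] means that [W] only connects
    indices with equal eigenvalues, a property inherited by [phi \o l]. The function must factor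
    through [l]: an arbitrary function of the index could split a degenerate eigenspace. *)
Lemma specf_comm {R : realType} {n} (V S : 'M[R[i]]_n) (l : 'I_n -> R) (phi : R -> R) :
  unitary V -> S *m specf V l = specf V l *m S ->
  S *m specf V (phi \o l) = specf V (phi \o l) *m S.
Proof.
move=> [u v] h.
pose W := V *m S *m adjmx V.
have conjE f : V *m (S *m specf V f) *m adjmx V = W *m diag_mx (\row_k rc (f k)).
  by rewrite /specf /W !mulmxA -[_ *m V *m adjmx V]mulmxA v mulmx1.
have conjE' f : V *m (specf V f *m S) *m adjmx V = diag_mx (\row_k rc (f k)) *m W.
  by rewrite /specf /W !mulmxA v mul1mx.
have dE (f : 'I_n -> R) k : (\row_k rc (f k)) 0 k = rc (f k) by rewrite mxE.
have e i j : rc (l i) * W i j = W i j * rc (l j).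
  move: (conjE l); rewrite h conjE' => /matrixP /(_ i j).
  by rewrite mul_diag_mx mul_mx_diag [LHS]mxE [RHS]mxE !dE.
have key : W *m diag_mx (\row_k rc (phi (l k))) = diag_mx (\row_k rc (phi (l k))) *m W.
  apply/matrixP => i j; rewrite mul_diag_mx mul_mx_diag [LHS]mxE [RHS]mxE !dE.
  have [-> |ne] := eqVneq (W i j) 0; first by rewrite mulr0 mul0r.
  suff -> : l i = l j by rewrite mulrC.
  by move: (e i j); rewrite mulrC => /(mulfI ne) [->].
have := conjE (phi \o l); rewrite /= key -conjE' => /(congr1 (fun X => adjmx V *m X *m V)).
by rewrite !mulmxA u !mul1mx -!mulmxA u !mulmx1.
Qed.

(** Invariance of the entries under [s] is commutation with its permutation matrix. This carries
    lattice symmetries from K over to its spectral projections. *)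
Lemma specf_perm {R : realType} {n} (V : 'M[R[i]]_n) (s : {perm 'I_n}) (l : 'I_n -> R) (phi : R -> R) :
  unitary V -> (forall x y, specf V l (s x) (s y) = specf V l x y) ->
  forall x y, specf V (phi \o l) (s x) (s y) = specf V (phi \o l) x y.
Proof.
move=> u h x y.
have : perm_mx s *m specf V (phi \o l) = specf V (phi \o l) *m perm_mx s.
  apply: specf_comm => //; rewrite -row_permE -{2}[s]invgK -col_permE.
  by apply/matrixP => i j; rewrite [LHS]mxE [RHS]mxE -[RHS]h permKV.
rewrite -row_permE -{2}[s]invgK -col_permE => /matrixP /(_ x (s y)).
by rewrite [LHS]mxE [RHS]mxE permK.
Qed.

(** * Eigenvalues and the characteristic polynomial *)

Lemma char_poly_specf {R : realType} {n} (V : 'M[R[i]]_n) (A : 'M[R]_n) (l : 'I_n -> R) :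
  unitary V -> cplx A = specf V l -> char_poly A = \prod_k ('X - (l k)%:P).
Proof.
move=> [u v] eA; apply: (map_poly_inj (real_complex R)).
rewrite map_char_poly -/(cplx A) eA rmorph_prod.
have -> : char_poly (specf V l) = char_poly (diag_mx (\row_k rc (l k))).
  rewrite /char_poly.
  have -> : char_poly_mx (specf V l) = map_mx polyC (adjmx V) *m
      char_poly_mx (diag_mx (\row_k rc (l k))) *m map_mx polyC V.
    rewrite /char_poly_mx mulmxBr mulmxBl -!map_mxM /= -/(specf V l); congr (_ - _).
    by rewrite mul_mx_scalar -scalemxAl -map_mxM /= u map_mx1 scalemx1.
  rewrite !det_mulmx mulrAC -det_mulmx -map_mxM /= u map_mx1 det1 mul1r //.
rewrite char_poly_trig; last by apply/is_trig_mxP => i j lij; rewrite !mxE lt_eqF.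
by apply: eq_bigr => k _; rewrite !mxE eqxx mulr1n rmorphB /= map_polyX map_polyC.
Qed.

Lemma mem_rootsR_specf {R : realType} {n} (V : 'M[R[i]]_n) (A : 'M[R]_n) (l : 'I_n -> R) k :
  unitary V -> cplx A = specf V l -> l k \in rootsR (char_poly A).
Proof.
move=> u eA; have p0 : char_poly A != 0 by rewrite monic_neq0 // char_poly_monic.
have := roots_on_rootsR p0 (l k); rewrite inE /= => <-.
by rewrite (char_poly_specf _ _ _ u eA) (bigD1 k) //= rootM root_XsubC eqxx.
Qed.

(** [trace_neg] runs over distinct roots weighted by multiplicity, and the multiplicity of [r]
    counts the indices with [l k = r]. Exchanging the two sums leaves exactly one root for each
    index. *)
Lemma trace_neg_specf {R : realType} {n} (V : 'M[R[i]]_n) (A : 'M[R]_n) (l : 'I_n -> R) :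
  unitary V -> cplx A = specf V l -> trace_neg A = \sum_(k | l k < 0) l k.
Proof.
move=> u eA; rewrite /trace_neg.
have mupE r : r *+ mup r (char_poly A) = \sum_(k | l k == r) l k.
  rewrite (eq_bigr (fun=> r)); last by move=> k /eqP.
  rewrite sumr_const; congr (_ *+ _).
  rewrite (char_poly_specf _ _ _ u eA).
  have h (s : seq 'I_n) : mup r (\prod_(k <- s) ('X - (l k)%:P)) = count (fun k => l k == r) s.
    elim: s => [|k s IH]; first by rewrite big_nil /= mupNroot // root1.
    rewrite big_cons mupM ?polyXsubC_eq0 //; last first.
      by rewrite prodf_seq_neq0; apply/allP => j _; rewrite polyXsubC_eq0.
    by rewrite IH -['X - _]expr1 mup_XsubCX /=; case: eqP.
  by rewrite h -sum1_count -sum1_card.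
rewrite (eq_bigr _ (fun r _ => mupE r)) (exchange_big_dep (fun k => l k < 0)) /=; last first.
  by move=> r k hr /eqP ->.
apply: eq_bigr => k lk.
rewrite big_const_seq (_ : count _ _ = 1%N) /= ?addr0 //.
transitivity (count_mem (l k) (rootsR (char_poly A))).
  by apply: eq_count => r /=; rewrite [r == _]eq_sym; case: eqP => [<-|]; rewrite ?lk ?andbF.
by rewrite count_uniq_mem ?uniq_roots // (mem_rootsR_specf V _ l).
Qed.

(** * The energy inequality *)

Definition negproj {R : realType} {n} (V : 'M[R[i]]_n) (l : 'I_n -> R) : 'M[R[i]]_n :=
  specf V (fun k => (l k < 0)%R%:R).

Lemma wt_specfr {R : realType} {n} (V X : 'M[R[i]]_n) f k : unitary V ->
  wt V (X *m specf V f) k = f k * wt V X k.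
Proof.
move=> [_ u]; rewrite /wt /specf !mulmxA -[_ *m V *m adjmx V]mulmxA u mulmx1.
by rewrite mul_mx_diag [X in Re X]mxE [(\row__ _) 0 k]mxE mulrC ReZ.
Qed.

Lemma wt_specfl {R : realType} {n} (V X : 'M[R[i]]_n) f k : unitary V ->
  wt V (specf V f *m X) k = f k * wt V X k.
Proof.
move=> [_ u]; rewrite /wt /specf !mulmxA u mul1mx -!mulmxA.
by rewrite mul_diag_mx [X in Re X]mxE [(\row__ _) 0 k]mxE ReZ.
Qed.

Lemma wt_specf {R : realType} {n} (V : 'M[R[i]]_n) f k : unitary V ->
  wt V (specf V f) k = f k.
Proof. by move=> u; rewrite -[specf V f]mul1mx wt_specfr // wt1 // mulr1. Qed.

Lemma negproj_idem {R : realType} {n} (V : 'M[R[i]]_n) l : unitary V ->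
  negproj V l *m negproj V l = negproj V l.
Proof. by move=> u; rewrite (specfM _ _ _ u); apply: eq_specf => k; case: ltP; rewrite ?mulr1 ?mulr0. Qed.

Lemma negproj_density {R : realType} {n} (V : 'M[R[i]]_n) l : unitary V ->
  density_matrix (negproj V l).
Proof.
move=> u; have hP : Defs.hermitian (negproj V l) by exact: specf_herm.
split.
  by rewrite -negproj_idem // -{1}hP -[adjmx _]mulmx1; apply: psd_congr; exact: psd1.
have -> : 1%:M - negproj V l = adjmx (1%:M - negproj V l) *m 1%:M *m (1%:M - negproj V l).
  rewrite mulmx1 adjmxD adjmxN adjmx1 hP mulmxBr mulmxBl mul1mx mulmx1 mulmxBl mul1mx.
  by rewrite negproj_idem // subrr subr0.
by apply: psd_congr; exact: psd1.
Qed.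

(** The form <X e_x, |K| X e_x> written in the eigenbasis, so that |K| itself is never formed. *)
Definition gain {R : realType} {n} (V : 'M[R[i]]_n) (l : 'I_n -> R) (X : 'M[R[i]]_n) (x : 'I_n) : R :=
  \sum_k `|l k| * sq ((V *m X) k x).

Lemma gain_ge0 {R : realType} {n} (V : 'M[R[i]]_n) l X x : 0 <= gain V l X x.
Proof. by apply: sumr_ge0 => k _; rewrite mulr_ge0 ?sq_ge0. Qed.

Lemma sum_gain {R : realType} {n} (V : 'M[R[i]]_n) l (X : 'M[R[i]]_n) : Defs.hermitian X ->
  \sum_x gain V l X x = \sum_k `|l k| * wt V (X *m X) k.
Proof.
move=> hX; rewrite exchange_big /=; apply: eq_bigr => k _.
by rewrite wt_sqr // mulr_sumr.
Qed.

(* Uses [1 - g = (1 - g)^2 + (g - g^2)] for [g = gu + gd], where [g - g^2] is nonnegative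
   up to the anticommutator of [gu] and [gd]. *)
Lemma kinetic_lower_bound {R : realType} {n} (V : 'M[R[i]]_n) l (gu gd : 'M[R[i]]_n) : unitary V ->
  density_matrix gu -> density_matrix gd ->
  2^-1 * (\sum_x gain V l (gu + gd - negproj V l) x)
   - \sum_(k | l k < 0) - l k * wt V (gu *m gd + gd *m gu) k
  <= Re (\tr (specf V l *m (gu + gd))) - \sum_(k | l k < 0) l k.
Proof.
move=> u du dd; set P := negproj V l; set g := gu + gd.
have hP : Defs.hermitian P by exact: specf_herm.
have hD : Defs.hermitian (g - P).
  by rewrite /Defs.hermitian !adjmxD adjmxN du.1.1 dd.1.1 hP.
rewrite (sum_gain _ _ _ hD) tr_specf ![\sum_(k | l k < 0) _]big_mkcond /= mulr_sumr -!sumrB.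
apply: ler_sum => k _.
have eD : wt V ((g - P) *m (g - P)) k =
    wt V (g *m g) k - 2 * ((l k < 0)%R%:R * wt V g k) + (l k < 0)%R%:R.
  rewrite mulmxBl !mulmxBr negproj_idem // !(wtD, wtN) wt_specfl // wt_specfr // wt_specf //.
  rewrite ?[wt V g k]wtD; move: (wt V gu k) (wt V gd k) (wt V (g *m g) k) => a b e; ring.
have eg : wt V (g *m g) k = wt V (gu *m gu) k + wt V (gd *m gd) k + wt V (gu *m gd + gd *m gu) k.
  rewrite /g mulmxDl !mulmxDr !wtD.
  move: (wt V (gu *m gu) k) (wt V (gd *m gd) k) (wt V (gu *m gd) k) (wt V (gd *m gu) k) => a b e h; ring.
have D0 : 0 <= wt V ((g - P) *m (g - P)) k.
  by rewrite wt_sqr // sumr_ge0 // => x _; exact: sq_ge0.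
have h2 : wt V (g *m g) k <= 2 * wt V (gu *m gu) k + 2 * wt V (gd *m gd) k.
  have hB : Defs.hermitian (gu - gd) by rewrite /Defs.hermitian adjmxD adjmxN du.1.1 dd.1.1.
  have : 0 <= wt V ((gu - gd) *m (gu - gd)) k.
    by rewrite wt_sqr // sumr_ge0 // => x _; exact: sq_ge0.
  rewrite eg mulmxBl !mulmxBr !(wtD, wtN).
  by move: (wt V (gu *m gu) k) (wt V (gd *m gd) k) (wt V (gu *m gd) k) (wt V (gd *m gu) k) => a b e h {eD eg D0}; lra.
have hu : wt V (gu *m gu) k <= wt V gu k.
  by have := wt_ge0 V _ k (density_sub_sq _ du); rewrite wtD wtN subr_ge0.
have hd : wt V (gd *m gd) k <= wt V gd k.
  by have := wt_ge0 V _ k (density_sub_sq _ dd); rewrite wtD wtN subr_ge0.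
have egs : wt V g k = wt V gu k + wt V gd k by rewrite wtD.
move: eD eg D0 h2 hu hd egs.
move: (wt V ((g - P) *m (g - P)) k) (wt V (g *m g) k) (wt V g k) (wt V (gu *m gu) k)
  (wt V (gd *m gd) k) (wt V gu k) (wt V gd k) (wt V (gu *m gd + gd *m gu) k) => d g2 g1 u2 d2 u1 d1 s.
(* For [l k < 0] one has [1 - g1 = d + g1 - g2 >= d - s]. For [l k >= 0] one has [d = g2 <= 2 * g1],
   and this case is responsible for the factor 1/2 in front of the gain. *)
case: ltP => lk /= eD eg D0 h2 hu hd egs.
  rewrite ltr0_norm // -subr_ge0.
  have : 0 <= - l k * (1 - g1 + s - 2^-1 * d) by apply: mulr_ge0; lra.
  lra.
rewrite ger0_norm // subr0 subr0.
have : 0 <= l k * (g1 - 2^-1 * d) by apply: mulr_ge0; lra.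
lra.
Qed.

(** Summing over the intermediate site [y] between [gu] and [gd] localizes the error term, so that
    sites where one density vanishes can be discarded. *)
Lemma sum_wt_anticommutator {R : realType} {n} (V : 'M[R[i]]_n) (N : 'I_n -> R) (gu gd : 'M[R[i]]_n) (Q : pred 'I_n) :
  Defs.hermitian gu -> Defs.hermitian gd ->
  \sum_(k | Q k) N k * wt V (gu *m gd + gd *m gu) k =
  \sum_y 2 * Re (\sum_(k | Q k) rc (N k) * (V *m gu) k y * Num.conj ((V *m gd) k y)).
Proof.
move=> hu hd; under [RHS]eq_bigr do rewrite Re_sum mulr_sumr.
rewrite exchange_big /=; apply: eq_bigr => k _.
rewrite wtD !wt_mul // -big_split /= mulr_sumr; apply: eq_bigr => y _.
rewrite -mulrA ReZ mulrCA; congr (_ * _).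
by case: ((V *m gu) k y) => a b; case: ((V *m gd) k y) => c e /=; ring.
Qed.

(** Cauchy-Schwarz in [k]; by Parseval each factor is at most the squared norm of column [y] of a
    density matrix, hence at most its density at [y]. *)
Lemma anticommutator_site_bound {R : realType} {n} (V : 'M[R[i]]_n) (N : 'I_n -> R) (c : R) (gu gd : 'M[R[i]]_n) (Q : pred 'I_n) y :
  unitary V -> density_matrix gu -> density_matrix gd -> (forall k, `|N k| <= c) ->
  sq (\sum_(k | Q k) rc (N k) * (V *m gu) k y * Num.conj ((V *m gd) k y))
  <= c ^+ 2 * (Re (gu y y) * Re (gd y y)).
Proof.
move=> u du dd hN.
have hat (g : 'M[R[i]]_n) : density_matrix g -> \sum_k sq ((V *m g) k y) <= Re (g y y).
  by move=> dg; rewrite parseval //; exact: density_col_bound.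
have sub (F : 'I_n -> R) : (forall k, 0 <= F k) -> \sum_(k | Q k) F k <= \sum_k F k.
  by move=> F0; rewrite big_mkcond; apply: ler_sum => k _; case: ifP.
apply: (le_trans (cauchy_schwarz _ _ _ _)).
rewrite mulrA; apply: ler_pM; try by apply: sumr_ge0 => k _; exact: sq_ge0.
- apply: (@le_trans _ _ (\sum_k c ^+ 2 * sq ((V *m gu) k y))); last first.
    by rewrite -mulr_sumr ler_wpM2l ?sqr_ge0 ?hat.
  apply: le_trans (sub _ _); last by move=> k; rewrite mulr_ge0 ?sqr_ge0 ?sq_ge0.
  apply: ler_sum => k _; rewrite sqM sq_rc ler_wpM2r ?sq_ge0 //.
  by rewrite -real_normK ?num_real // lerXn2r // nnegrE ?(le_trans _ (hN k)).
- apply: (le_trans _ (hat _ dd)); apply: (le_trans _ (sub _ _)) => [|k]; last exact: sq_ge0.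
  by apply: ler_sum => k _; rewrite sq_conj.
Qed.

(** Young's inequality for 2 c sqrt(s). Only half of the interaction [W * s] is spent on the error;
    the other half remains to pay for bad sites. *)
Lemma loss_bound {R : realType} (z c s W : R) : 0 < c -> 0 < W ->
  z ^+ 2 <= c ^+ 2 * s -> 2 * z <= W / 2 * s + 2 * c ^+ 2 / W.
Proof.
move=> c0 W0 h.
have c2 : 0 < c ^+ 2 by rewrite exprn_gt0.
have h1 : z ^+ 2 / c ^+ 2 <= s by rewrite ler_pdivrMr // mulrC.
have h2 : W / 2 * (z ^+ 2 / c ^+ 2) <= W / 2 * s by rewrite ler_wpM2l //; lra.
have h3 : 0 <= (W * z - 2 * c ^+ 2) ^+ 2 / (2 * c ^+ 2 * W).
  by rewrite divr_ge0 ?sqr_ge0 // !mulr_ge0 // ltW.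
have h4 : (W * z - 2 * c ^+ 2) ^+ 2 / (2 * c ^+ 2 * W) =
   W / 2 * (z ^+ 2 / c ^+ 2) - 2 * z + 2 * c ^+ 2 / W by field; rewrite !gt_eqF.
lra.
Qed.

(** * Cutting off the minority spin, and the resulting energy balance *)

Definition cut {R : realType} {n} (A : pred 'I_n) (g : 'M[R[i]]_n) : 'M[R[i]]_n :=
  \matrix_(x, y) (if A x || A y then 0 else g x y).

(** With Q the coordinate projection onto the complement of [A], the cut matrix is Q g Q, and 1 - Q
    g Q = Q (1-g) Q + (1-Q). *)
Lemma cut_density {R : realType} {n} (A : pred 'I_n) (g : 'M[R[i]]_n) :
  density_matrix g -> density_matrix (cut A g).
Proof.
move=> [pg p1].
pose ind (Q : pred 'I_n) : 'M[R[i]]_n := diag_mx (\row_k (Q k)%:R).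
have indH Q : adjmx (ind Q) = ind Q.
  by apply/matrixP => i j; rewrite !mxE rmorphMn /= rmorph_nat eq_sym; case: eqP => [->|].
have indE Q (X : 'M[R[i]]_n) i j : (ind Q *m X *m ind Q) i j = (Q i)%:R * (Q j)%:R * X i j.
  by rewrite mul_mx_diag mul_diag_mx !mxE mulrAC.
have -> : cut A g = adjmx (ind (predC A)) *m g *m ind (predC A).
  apply/matrixP => i j; rewrite indH indE mxE /=.
  by case: (A i); case: (A j); rewrite /= ?mul0r ?mulr0 ?mul0r ?mul1r.
split; first exact: psd_congr.
have -> : 1%:M - adjmx (ind (predC A)) *m g *m ind (predC A) =
    adjmx (ind (predC A)) *m (1%:M - g) *m ind (predC A) + adjmx (ind A) *m 1%:M *m ind A.
  apply/matrixP => i j; rewrite !indH mxE [RHS]mxE [X in _ + X]mxE !indE !mxE /=.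
  case: (eqVneq i j) => [->|ne]; case: (A i); case: (A j); rewrite ?mulr0n ?mulr1n /=; ring.
by apply: psdD; [exact: (psd_congr _ _ p1)|exact: (psd_congr _ _ psd1)].
Qed.

(** The removed entries lie in rows or columns indexed by [A]. By hermiticity both kinds have the
    same total mass, and each column is bounded by its diagonal entry. *)
Lemma cut_diff_hs {R : realType} {n} (A : pred 'I_n) (g : 'M[R[i]]_n) :
  density_matrix g ->
  \sum_x \sum_y sq ((g - cut A g) y x) <= 2 * \sum_(x | A x) Re (g x x).
Proof.
move=> dg.
have h : \sum_x \sum_y sq ((g - cut A g) y x) <=
    \sum_x \sum_y (A x)%:R * sq (g y x) + \sum_x \sum_y (A y)%:R * sq (g y x).
  rewrite -big_split; apply: ler_sum => x _ /=; rewrite -big_split; apply: ler_sum => y _ /=.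
  rewrite !mxE; have := sq_ge0 (g y x).
  case: (A x); case: (A y); rewrite /= ?subr0 ?subrr ?sq0 ?mul1r ?mul0r ?addr0 ?add0r //.
  by move=> s0; rewrite lerDl.
have e : \sum_x \sum_y (A y)%:R * sq (g y x) = \sum_x \sum_y (A x)%:R * sq (g y x).
  rewrite exchange_big /=; apply: eq_bigr => x _; apply: eq_bigr => y _.
  by rewrite (herm_entry g x y dg.1.1) sq_conj.
apply: (le_trans h); rewrite e -[leLHS]mulr2n -[leLHS]mulr_natl ler_wpM2l //.
rewrite [leRHS]big_mkcond; apply: ler_sum => x _; rewrite -mulr_sumr.
by case: (A x); rewrite ?mul0r // mul1r; exact: density_col_bound.
Qed.

Lemma sum_edges {R : realType} {n} (T : rel 'I_n) (q : R) (f : 'I_n -> R) :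
  symmetric T -> (forall x, \sum_y (T x y)%:R = q) ->
  \sum_x \sum_y (T x y)%:R * (f x + f y) = 2 * q * \sum_x f x.
Proof.
move=> sT hq.
have e1 : \sum_x \sum_y (T x y)%:R * f x = q * \sum_x f x.
  by rewrite mulr_sumr; apply: eq_bigr => x _; rewrite -mulr_suml hq.
have e2 : \sum_x \sum_y (T x y)%:R * f y = q * \sum_x f x.
  by rewrite exchange_big -e1; apply: eq_bigr => x _; apply: eq_bigr => y _; rewrite sT.
rewrite -mulrA mulr2n mulrDl !mul1r -{1}e1 -e2 -big_split; apply: eq_bigr => x _ /=.
by rewrite -big_split; apply: eq_bigr => y _; rewrite mulrDr.
Qed.

(** The cut removes the diagonal on [A] and all hopping that touches [A]. Hopping inside [A] is
    bounded by the density there. An edge leaving [A] ends in [B], where only density <= 1 is known;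
    splitting it with weight [kappa] makes the bad end cost only 1/[kappa]. *)
Lemma cut_kinetic {R : realType} {n} (K g : 'M[R[i]]_n) (T : rel 'I_n) (t q kappa : R) (A B : pred 'I_n) :
  symmetric T -> (forall x, \sum_y (T x y)%:R = q) ->
  (forall x y, K x y = rc (t * (x == y)%:R - (T x y)%:R)) ->
  (forall x y, T x y -> A x -> A y || B y) ->
  1 <= kappa -> density_matrix g ->
  - (`|t| + q * kappa) * (\sum_(x | A x) Re (g x x)) - q / kappa * (\sum_x (B x)%:R)
  <= Re (\tr (K *m g)) - Re (\tr (K *m cut A g)).
Proof.
move=> sT hq hK hAB k1 dg.
have k0 : 0 < kappa by apply: lt_le_trans k1; exact: ltr01.
(* The cost charged to a site: twice the hopping removed along an edge is at most the sum of [h] at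
   its two ends. *)
pose h x := kappa * ((A x)%:R * Re (g x x)) + (B x)%:R / kappa.
pose X := g - cut A g.
have XE y x : X y x = (A x || A y)%:R * g y x.
  by rewrite !mxE orbC; case: (_ || _); rewrite ?mul1r ?mul0r ?subr0 ?subrr.
have rho0 x : 0 <= Re (g x x) by exact: psd_diag dg.1.
have b0 x : 0 <= (B x)%:R / kappa by rewrite divr_ge0 ?ler0n // ltW.
have h0 x : 0 <= h x by rewrite addr_ge0 // !mulr_ge0 ?ler0n // ltW.
have mixed x y : T x y -> A x -> ~~ A y -> 2 * Re (g y x) <= h x + h y.
  move=> Txy Ax nAy; have By : B y by have := hAB x y Txy Ax; rewrite (negbTE nAy).
  rewrite /h Ax (negbTE nAy) By !mul1r !mul0r mulr0 add0r.
  have := psd_offdiag g x y kappa dg.1 k0; rewrite (herm_entry g x y dg.1.1) Re_conj.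
  have : Re (g y y) / kappa <= kappa^-1.
    by rewrite ler_pdivrMr // mulVf ?gt_eqF //; exact: density_diag_le1.
  have := b0 x.
  move: (kappa^-1) (Re (g x x)) (Re (g y x)) ((B x)%:R / kappa) (Re (g y y) / kappa) => f a z e b; lra.
have edge x y : T x y -> 2 * Re (X y x) <= h x + h y.
  move=> Txy; rewrite XE; have [Ax|nAx] := boolP (A x); have [Ay|nAy] := boolP (A y) => /=.
  - rewrite mul1r /h Ax Ay !mul1r.
    have := psd_offdiag g y x 1 dg.1 ltr01; have := rho0 x; have := rho0 y; have := b0 x; have := b0 y.
    rewrite mul1r divr1.
    move: (Re (g x x)) (Re (g y y)) (Re (g y x)) ((B x)%:R / _) ((B y)%:R / _) => a b z e f f0 e0 b0' a0.
    have : 0 <= (kappa - 1) * a by rewrite mulr_ge0 // subr_ge0.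
    have : 0 <= (kappa - 1) * b by rewrite mulr_ge0 // subr_ge0.
    lra.
  - by rewrite mul1r mixed.
  - by rewrite mul1r (herm_entry g y x dg.1.1) Re_conj addrC mixed // sT.
  - by rewrite mul0r mulr0 addr_ge0.
have trE : Re (\tr (K *m g)) - Re (\tr (K *m cut A g)) =
    t * (\sum_(x | A x) Re (g x x)) - \sum_x \sum_y (T x y)%:R * Re (X y x).
  rewrite -ReB -raddfB -mulmxBr -/X /mxtrace Re_sum [X in t * X]big_mkcond mulr_sumr -sumrB.
  apply: eq_bigr => x _; rewrite mxE Re_sum.
  under eq_bigr do rewrite hK ReZ mulrBl.
  rewrite sumrB (bigD1 x) //= big1 ?addr0 => [|y /negbTE ne]; last first.
    by rewrite eq_sym ne mulr0 mul0r.
  by rewrite eqxx mulr1 XE orbb; case: (A x); rewrite ?mul1r ?mul0r.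
have sumT : \sum_x \sum_y (T x y)%:R * Re (X y x) <= q * \sum_x h x.
  rewrite -(ler_pM2l (ltr0n R 2)) mulrA -(sum_edges T q h sT hq) mulr_sumr.
  apply: ler_sum => x _; rewrite mulr_sumr; apply: ler_sum => y _.
  rewrite mulrCA; case Txy: (T x y); last by rewrite !mul0r.
  by rewrite !mul1r; exact: edge.
have sumh : \sum_x h x = kappa * (\sum_(x | A x) Re (g x x)) + (\sum_x (B x)%:R) / kappa.
  rewrite big_split /= -mulr_sumr -mulr_suml; congr (_ * _ + _).
  by rewrite [RHS]big_mkcond; apply: eq_bigr => x _; case: (A x); rewrite ?mul1r ?mul0r.
have tau0 : 0 <= \sum_(x | A x) Re (g x x) by apply: sumr_ge0.
rewrite trE; move: sumT; rewrite sumh.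
move: tau0; move: (\sum_(x | A x) Re (g x x)) (\sum_x (B x)%:R)
  (\sum_x \sum_y (T x y)%:R * Re (X y x)) => tau b S tau0.
have : - `|t| * tau <= t * tau by rewrite ler_wpM2r // lerNl -normrN ler_norm.
rewrite [q / kappa * b]mulrAC mulrDr !mulrA.
lra.
Qed.

(** Leads back from the gain of the cut densities, which the kinetic bound provides, to the gain of
    the original ones, by which bad sites are defined. Parseval turns the difference into a
    Hilbert-Schmidt norm. *)
Lemma gain_perturb {R : realType} {n} (V : 'M[R[i]]_n) (l : 'I_n -> R) (c : R) (X Y : 'M[R[i]]_n) :
  unitary V -> (forall k, `|l k| <= c) ->
  \sum_x gain V l X x <= 2 * (\sum_x gain V l Y x) + 2 * c * (\sum_x \sum_y sq ((X - Y) y x)).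
Proof.
move=> u lc; rewrite !mulr_sumr -big_split; apply: ler_sum => x _ /=.
rewrite -(parseval V _ _ x u) /gain !mulr_sumr -big_split; apply: ler_sum => k _ /=.
have -> : (V *m X) k x = (V *m Y) k x + (V *m (X - Y)) k x.
  by rewrite mulmxBr [X in _ = _ + X]mxE [X in _ + (_ + X)]mxE addrC subrK.
have := ler_wpM2l (normr_ge0 (l k)) (sqD ((V *m Y) k x) ((V *m (X - Y)) k x)).
have := ler_wpM2r (sq_ge0 ((V *m (X - Y)) k x)) (lc k).
move: (sq _) (sq ((V *m Y) k x)) (sq ((V *m (X - Y)) k x)) (`|l k|) => a b e f; lra.
Qed.

(** At a coloured site the majority density is at least [r0], so the interaction there dominates
    [W * r0] times the minority density. This is the term that pays for the cut. *)
Lemma interaction_split {R : realType} {n} (B Au Ad : pred 'I_n) (W r0 : R) (ru rd : 'I_n -> R) :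
  0 <= W -> (forall x, 0 <= ru x) -> (forall x, 0 <= rd x) ->
  (forall x, Au x -> ~~ B x /\ r0 <= ru x) -> (forall x, Ad x -> ~~ B x /\ r0 <= rd x) ->
  (forall x, Au x -> ~~ Ad x) ->
  \sum_x (B x)%:R * (W * (ru x * rd x)) + W * r0 * (\sum_(x | Ad x) ru x + \sum_(x | Au x) rd x)
  <= W * (\sum_x ru x * rd x).
Proof.
move=> W0 u0 d0 hu hd hud.
rewrite [\sum_(x | Ad x) _]big_mkcond [\sum_(x | Au x) _]big_mkcond -big_split /= !mulr_sumr -big_split.
apply: ler_sum => x _ /=.
have s0 : 0 <= W * (ru x * rd x) by rewrite !mulr_ge0.
case Aux: (Au x).
  have [/negbTE -> rx] := hu x Aux; rewrite (negbTE (hud x Aux)) !add0r mul0r add0r -mulrA.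
  by rewrite ler_wpM2l // ler_wpM2r.
case Adx: (Ad x).
  have [/negbTE -> rx] := hd x Adx; rewrite addr0 mul0r add0r -mulrA.
  by rewrite ler_wpM2l // mulrC ler_wpM2l.
by rewrite addr0 mulr0 addr0; case: (B x); rewrite ?mul1r ?mul0r.
Qed.

(** Outside [B] the product of the densities is 0, so the site bound annihilates the error; inside
    [B] it is absorbed by [loss_bound]. *)
Lemma loss_sum_bound {R : realType} {n} (V : 'M[R[i]]_n) (l : 'I_n -> R) (c W : R) (B : pred 'I_n)
    (gu gd : 'M[R[i]]_n) :
  unitary V -> (forall k, `|l k| <= c) -> 0 < c -> 0 < W ->
  density_matrix gu -> density_matrix gd ->
  (forall x, ~~ B x -> gu x x = 0 \/ gd x x = 0) ->
  \sum_(k | l k < 0) - l k * wt V (gu *m gd + gd *m gu) k <=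
  \sum_x (B x)%:R * (W / 2 * (Re (gu x x) * Re (gd x x)) + 2 * c ^+ 2 / W).
Proof.
move=> u lc c0 W0 du dd hB.
rewrite (sum_wt_anticommutator V _ gu gd _ du.1.1 dd.1.1); apply: ler_sum => x _.
have := anticommutator_site_bound V (fun k => - l k) c gu gd (fun k => l k < 0) x u du dd.
move=> /(_ (fun k => eq_ind_r (fun z => z <= c) (lc k) (normrN (l k)))).
set z := \sum_(k | l k < 0) _ => hz.
case Bx: (B x); rewrite ?mul1r ?mul0r.
  by apply: loss_bound => //; apply: le_trans (Re_sq _) hz.
have s0 : Re (gu x x) * Re (gd x x) = 0.
  by have [->|->] := hB x (negbT Bx); rewrite /= ?mul0r ?mulr0.
have -> : z = 0.
  by apply: sq_eq0; apply/eqP; rewrite eq_le sq_ge0 andbT; move: hz; rewrite s0 mulr0.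
by rewrite mulr0.
Qed.

Lemma cut_Re_diag {R : realType} {n} (A : pred 'I_n) (g : 'M[R[i]]_n) x :
  ~~ A x -> cut A g x x = g x x.
Proof. by move=> /negbTE h; rewrite mxE h. Qed.

(* [B] are the bad sites, [Au] and [Ad] the good sites with majority spin up and down;
   [kinetic_lower_bound] is applied after cutting [gu] off on [Ad] and [gd] off on [Au]. *)
Lemma energy_gap {R : realType} {n} (V : 'M[R[i]]_n) (l : 'I_n -> R) (T : rel 'I_n)
    (t q c W delta kappa r0 : R) (gu gd : 'M[R[i]]_n) (B Au Ad : pred 'I_n) :
  unitary V -> (forall x y, specf V l x y = rc (t * (x == y)%:R - (T x y)%:R)) ->
  (forall k, `|l k| <= c) -> 0 < c -> 0 < W -> 1 <= kappa -> symmetric T ->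
  (forall x, \sum_y (T x y)%:R = q) ->
  density_matrix gu -> density_matrix gd ->
  (forall x, B x -> delta <= gain V l (gu + gd - negproj V l) x + W * (Re (gu x x) * Re (gd x x))) ->
  (forall x, Au x -> ~~ B x /\ r0 <= Re (gu x x)) -> (forall x, Ad x -> ~~ B x /\ r0 <= Re (gd x x)) ->
  (forall x, Au x -> ~~ Ad x) -> (forall x, [|| B x, Au x | Ad x]) ->
  (forall x y, T x y -> Au x -> Au y || B y) -> (forall x y, T x y -> Ad x -> Ad y || B y) ->
  (delta / 4 - 2 * c ^+ 2 / W - 2 * (q / kappa)) * (\sum_x (B x)%:R)
   + (W * r0 - 2 * c - `|t| - q * kappa) * (\sum_(x | Ad x) Re (gu x x) + \sum_(x | Au x) Re (gd x x))
  <= Re (\tr (specf V l *m (gu + gd))) + W * (\sum_x Re (gu x x) * Re (gd x x)) - \sum_(k | l k < 0) l k.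
Proof.
move=> u hK lc c0 W0 k1 sT hq du dd hB hu hd hud cover Tu Td.
pose gu' := cut Ad gu; pose gd' := cut Au gd.
have du' : density_matrix gu' by exact: cut_density.
have dd' : density_matrix gd' by exact: cut_density.
have Re_ge0 (g : 'M[R[i]]_n) x : density_matrix g -> 0 <= Re (g x x) by move=> dg; exact: psd_diag dg.1.
have i1 := kinetic_lower_bound V l gu' gd' u du' dd'.
have i2 := cut_kinetic _ gu T t q kappa Ad B sT hq hK Td k1 du.
have i3 := cut_kinetic _ gd T t q kappa Au B sT hq hK Tu k1 dd.
have hB' x : ~~ B x -> gu' x x = 0 \/ gd' x x = 0.
  move=> nB; have := cover x; rewrite (negbTE nB) /= => /orP[a|a]; [right|left]; by rewrite mxE a.
have i4 := loss_sum_bound V l c W B gu' gd' u lc c0 W0 du' dd' hB'.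
have {}i4 : \sum_(k | l k < 0) - l k * wt V (gu' *m gd' + gd' *m gu') k <=
    2^-1 * (\sum_x (B x)%:R * (W * (Re (gu x x) * Re (gd x x)))) + 2 * c ^+ 2 / W * (\sum_x (B x)%:R).
  apply: (le_trans i4); rewrite !mulr_sumr -big_split; apply: ler_sum => x _ /=.
  case Bx: (B x); last by rewrite !mul0r !mulr0 addr0.
  rewrite /gu' /gd' !cut_Re_diag; last 2 first.
  - by apply/negP => a; have [] := hu x a; rewrite Bx.
  - by apply/negP => a; have [] := hd x a; rewrite Bx.
  by rewrite !mul1r mulr1 [W / 2]mulrC -[2^-1 * W * _]mulrA.
have i5 := gain_perturb V l c (gu + gd - negproj V l) (gu' + gd' - negproj V l) u lc.
have i6 : \sum_x \sum_y sq ((gu + gd - negproj V l - (gu' + gd' - negproj V l)) y x) <=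
    4 * (\sum_(x | Ad x) Re (gu x x) + \sum_(x | Au x) Re (gd x x)).
  have j1 := cut_diff_hs Ad gu du; have j2 := cut_diff_hs Au gd dd.
  apply: (@le_trans _ _ (2 * (\sum_x \sum_y sq ((gu - gu') y x)) + 2 * (\sum_x \sum_y sq ((gd - gd') y x)))).
    have -> : gu + gd - negproj V l - (gu' + gd' - negproj V l) = (gu - gu') + (gd - gd').
      by rewrite opprB addrA subrK opprD addrACA.
    rewrite !mulr_sumr -big_split; apply: ler_sum => x _ /=.
    rewrite !mulr_sumr -big_split; apply: ler_sum => y _ /=.
    by rewrite [X in sq X <= _]mxE; exact: sqD.
  move: j1 j2; rewrite -/gu' -/gd'.
  move: (\sum_x \sum_y sq ((gu - gu') y x)) (\sum_x \sum_y sq ((gd - gd') y x)) => a b.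
  move: (\sum_(x | Ad x) _) (\sum_(x | Au x) _) => a' b'; lra.
have i7 := interaction_split B Au Ad W r0 _ _ (ltW W0) (fun x => Re_ge0 gu x du) (fun x => Re_ge0 gd x dd) hu hd hud.
have i8 : delta * (\sum_x (B x)%:R) <= \sum_x gain V l (gu + gd - negproj V l) x
     + \sum_x (B x)%:R * (W * (Re (gu x x) * Re (gd x x))).
  rewrite mulr_sumr -big_split; apply: ler_sum => x _ /=.
  case Bx: (B x); first by rewrite mulr1 mul1r; exact: hB.
  by rewrite mulr0 mul0r addr0 gain_ge0.
have s0 : 0 <= \sum_x (B x)%:R * (W * (Re (gu x x) * Re (gd x x))).
  by apply: sumr_ge0 => x _; rewrite !mulr_ge0 ?ler0n ?Re_ge0 // ltW.
have i6' := ler_wpM2l (ltW c0) i6.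
have trD (X Y : 'M[R[i]]_n) : Re (\tr (specf V l *m (X + Y))) = Re (\tr (specf V l *m X)) + Re (\tr (specf V l *m Y)).
  by rewrite mulmxDr mxtraceD ReD.
(* Balance of the estimates: [i5] and [i6] give half the cut gain >= a quarter of the original gain
   minus 2c times the minority density. Half of the bad-site interaction survives [i4], so by [i8] a
   quarter of gain plus interaction yields [delta / 4] per bad site. Each of the two cuts costs
   [q / kappa] per bad site. *)
move: i1 i2 i3; rewrite !trD -/gu' -/gd'.
move: i4 i5 i6' i7 i8 s0.
move: (\sum_(x | Ad x) Re (gu x x)) (\sum_(x | Au x) Re (gd x x)) => tu td.
move: (\sum_x \sum_y _) (\sum_x gain V l (gu + gd - negproj V l) x) (\sum_x gain V l (gu' + gd' - negproj V l) x) => hs G G'.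
move: (\sum_x (B x)%:R) (\sum_x (B x)%:R * _) (\sum_x Re (gu x x) * _) => b S I.
move: (\sum_(k | l k < 0) l k) (\sum_(k | l k < 0) - l k * _) => E0 L.
move: (Re (\tr (specf V l *m gu))) (Re (\tr (specf V l *m gd))) (Re (\tr (specf V l *m gu'))) (Re (\tr (specf V l *m gd'))).
move=> Eu Ed Eu' Ed'.
move: (c ^+ 2 / W) (q / kappa) (`|t|) => cW qk t' {i6 hq hK lc hB hu hd k1 c0 W0 Re_ge0 trD}.
lra.
Qed.

(** * Good sites *)

Lemma sum_sq_unitary {R : realType} {n} (V : 'M[R[i]]_n) x : unitary V -> \sum_k sq (V k x) = 1.
Proof.
move=> u; have := parseval V _ (1%:M : 'M_n) x u; rewrite mulmx1 => ->.
rewrite (bigD1 x) //= big1 ?addr0 => [|y ne]; first by rewrite mxE eqxx sq_rc expr1n.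
by rewrite mxE (negbTE ne) sq0.
Qed.

(** The constant is 4 + 4 + 2, from applying |a+b|^2 <= 2|a|^2 + 2|b|^2 twice to columns of norm at
    most 1. *)
Lemma deviation_col_bound {R : realType} {n} (gu gd P : 'M[R[i]]_n) x :
  density_matrix gu -> density_matrix gd -> density_matrix P ->
  \sum_y sq ((gu + gd - P) y x) <= 10.
Proof.
move=> du dd dP.
have b (g : 'M[R[i]]_n) : density_matrix g -> \sum_y sq (g y x) <= 1.
  by move=> dg; apply: le_trans (density_col_bound _ _ dg) (density_diag_le1 _ _ dg).
apply: (@le_trans _ _ (4 * (\sum_y sq (gu y x)) + 4 * (\sum_y sq (gd y x)) + 2 * (\sum_y sq (P y x)))).
  rewrite !mulr_sumr -!big_split; apply: ler_sum => y _ /=.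
  rewrite [X in sq X]mxE [X in sq (X + _)]mxE [X in sq (_ + X)]mxE.
  have := sqD (gu y x + gd y x) (- P y x); have := sqD (gu y x) (gd y x); rewrite sqN.
  move: (sq (gu y x + gd y x - P y x)) (sq (gu y x + gd y x)) (sq (gu y x)) (sq (gd y x)) (sq (P y x)) => a s e f h; lra.
have := b _ du; have := b _ dd; have := b _ dP.
move: (\sum_y sq (gu y x)) (\sum_y sq (gd y x)) (\sum_y sq (P y x)) => a e f; lra.
Qed.

(* The part of [X y x] carried by the eigenvalues away from 0 is controlled by the gain,
   the rest by the local density of states near 0. *)
Lemma entry_le_gain {R : realType} {n} (V : 'M[R[i]]_n) (l : 'I_n -> R) (eta eps m : R) (X : 'M[R[i]]_n) x y :
  unitary V -> 0 < eta -> \sum_(k | `|l k| < eta) sq (V k y) <= eps ->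
  \sum_z sq (X z x) <= m ->
  sq (X y x) <= 2 * (gain V l X x / eta) + 2 * (eps * m).
Proof.
move=> u eta0 he hm.
have -> : X y x = \sum_k Num.conj (V k y) * (V *m X) k x.
  rewrite -[in LHS](mul1mx X) -u.1 -mulmxA mxE; apply: eq_bigr => k _.
  by rewrite adjmxE.
have sub (Q : pred 'I_n) (F : 'I_n -> R) : (forall k, 0 <= F k) -> \sum_(k | Q k) F k <= \sum_k F k.
  by move=> F0; rewrite big_mkcond; apply: ler_sum => k _; case: ifP.
rewrite (bigID (fun k => `|l k| < eta)) /= addrC; apply: (le_trans (sqD _ _)).
apply: lerD; rewrite ler_pM2l //; apply: (le_trans (cauchy_schwarz _ _ _ _)).
- rewrite -[leRHS]mul1r; apply: ler_pM; try by apply: sumr_ge0 => k _; exact: sq_ge0.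
    under eq_bigr do rewrite sq_conj.
    by rewrite -(sum_sq_unitary V y u); apply: sub => k; exact: sq_ge0.
  rewrite ler_pdivlMr // mulr_suml.
  apply: (le_trans _ (sub (fun k => ~~ (`|l k| < eta)) _ _)) => [|k]; last first.
    by rewrite mulr_ge0 ?sq_ge0.
  by apply: ler_sum => k; rewrite -leNgt => h; rewrite mulrC ler_wpM2r ?sq_ge0.
- apply: ler_pM; try by apply: sumr_ge0 => k _; exact: sq_ge0.
    by under eq_bigr do rewrite sq_conj.
  rewrite -(parseval V _ X x u) in hm; apply: le_trans hm.
  by apply: sub => k; exact: sq_ge0.
Qed.

Lemma Re_le_of_sq {R : realType} (z : R[i]) (a : R) : 0 <= a -> sq z <= a ^+ 2 -> `|Re z| <= a.
Proof.
move=> a0 h; rewrite -(@ler_pXn2r _ 2) ?nnegrE // real_normK ?num_real //.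
exact: le_trans (Re_sq z) h.
Qed.

Lemma good_site_density {R : realType} {n} (gu gd P : 'M[R[i]]_n) (p : R) x :
  0 < p -> p ^+ 2 <= Re (P x x) -> sq ((gu + gd - P) x x) <= (p ^+ 2 / 2) ^+ 2 ->
  p ^+ 2 / 2 <= Re (gu x x) + Re (gd x x).
Proof.
move=> p0 hP hD.
have p2 : 0 <= p ^+ 2 / 2 by rewrite divr_ge0 // sqr_ge0.
have := Re_le_of_sq _ _ p2 hD; rewrite ler_norml => /andP[+ _].
rewrite [X in Re X]mxE [X in Re (X + _)]mxE [X in Re (_ + X)]mxE ReB ReD.
move: hP p2; move: (Re (gu x x)) (Re (gd x x)) (Re (P x x)) (p ^+ 2) => a b e f; lra.
Qed.

(** An entry of a density matrix is bounded by the root of the density at either end, so small [gd]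
    at [x] and small [gu] at [y] make both entries at most p/6. Then p <= p/6 + p/6 + p^2/2 <= 5p/6,
    a contradiction: opposite colours cannot be adjacent. *)
Lemma good_edge_colour {R : realType} {n} (gu gd P : 'M[R[i]]_n) (p : R) x y :
  0 < p -> p <= 1 -> p <= Re (P y x) -> density_matrix gu -> density_matrix gd ->
  sq ((gu + gd - P) y x) <= (p ^+ 2 / 2) ^+ 2 ->
  Re (gu y y) <= (p / 6) ^+ 2 -> Re (gd x x) <= (p / 6) ^+ 2 -> False.
Proof.
move=> p0 p1 hP du dd hD hu hd.
have p2 : 0 <= p ^+ 2 / 2 by rewrite divr_ge0 // sqr_ge0.
have p6 : 0 <= p / 6 by lra.
have := Re_le_of_sq _ _ p2 hD.
have := Re_le_of_sq _ _ p6 (le_trans (density_entry_bound gd x y dd) hd).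
have := Re_le_of_sq _ _ p6 (le_trans (density_entry_bound gu y x du) hu).
rewrite (herm_entry gu x y du.1.1) Re_conj.
rewrite [(gu + gd - P) y x]mxE [(gu + gd) y x]mxE [(- P) y x]mxE ReB ReD.
rewrite !ler_norml => /andP[_ a] /andP[_ b] /andP[e _].
have : p ^+ 2 <= p by rewrite expr2 ler_piMl // ltW.
move: hP a b e; move: (Re (gu y x)) (Re (gd y x)) (Re (P y x)) (p ^+ 2) => a b e f; lra.
Qed.

Lemma density_diag0 {R : realType} {n} (g : 'M[R[i]]_n) : density_matrix g ->
  (forall x, Re (g x x) <= 0) -> g = 0.
Proof.
move=> dg h; apply/matrixP => y x; rewrite mxE; apply: sq_eq0.
by apply/eqP; rewrite eq_le sq_ge0 andbT; apply: le_trans (density_entry_bound g x y dg) (h x).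
Qed.

(** The kinetic bound with second density 0 has no anticommutator term, so equality forces all gains
    to vanish; without zero eigenvalues this kills the whole deviation. *)
Lemma density_minimizer_unique {R : realType} {n} (V : 'M[R[i]]_n) (l : 'I_n -> R) (g : 'M[R[i]]_n) :
  unitary V -> (forall k, l k != 0) -> density_matrix g ->
  Re (\tr (specf V l *m g)) = \sum_(k | l k < 0) l k -> g = negproj V l.
Proof.
move=> u l0 dg e.
have := kinetic_lower_bound V l g 0 u dg density0.
rewrite addr0 e subrr mulmx0 mul0mx addr0.
rewrite [X in _ - X]big1 ?subr0 => [h|k _]; last first.
  by rewrite /wt mulmx0 mul0mx mxE mulr0.
have G0 : \sum_x gain V l (g - negproj V l) x = 0.
  apply/eqP; rewrite eq_le sumr_ge0 ?andbT; last by move=> x _; exact: gain_ge0.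
  by move: h; rewrite pmulr_rle0 // invr_gt0.
have gx x : gain V l (g - negproj V l) x = 0.
  move/eqP: G0; rewrite psumr_eq0 => [/allP /(_ x)|]; last by move=> z _; exact: gain_ge0.
  by rewrite mem_index_enum => /(_ isT) /eqP.
have VD : V *m (g - negproj V l) = 0.
  apply/matrixP => k x; rewrite [RHS]mxE; apply: sq_eq0.
  have := gx x; move/eqP; rewrite /gain psumr_eq0 => [/allP /(_ k)|]; last first.
    by move=> z _; rewrite mulr_ge0 ?sq_ge0.
  rewrite mem_index_enum => /(_ isT) /=; rewrite mulf_eq0 normr_eq0 (negbTE (l0 k)) /=.
  by move/eqP.
apply/eqP; rewrite -subr_eq0; apply/eqP.
by rewrite -[LHS]mul1mx -u.1 -mulmxA VD mulmx0.
Qed.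

(** The weight [kappa] is set to W r0 / (2q). Then [q * kappa] uses exactly half of the gain
    [W * r0], while [q / kappa] = 2 q^2 / (W r0) still decays in W. *)
Lemma coupling_threshold {R : realType} (t q c p delta r0 : R) :
  0 < q -> 0 < c -> 0 < p -> 0 < delta -> 0 < r0 ->
  exists W0 : R, 0 <= W0 /\ forall W, W0 <= W ->
    [/\ 0 < W, 1 <= W * r0 / (2 * q), delta <= W * r0 * (p / 6) ^+ 2,
        0 < delta / 4 - 2 * c ^+ 2 / W - 2 * (q / (W * r0 / (2 * q)))
      & 0 < W * r0 - 2 * c - `|t| - q * (W * r0 / (2 * q))].
Proof.
have aux (b1 b2 b3 b4 W : R) : 0 <= b1 -> 0 <= b2 -> 0 <= b3 -> 0 <= b4 ->
    1 + b1 + b2 + b3 + b4 <= W -> [/\ 0 < W, b1 <= W, b2 <= W, b3 < W & b4 < W].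
  by move=> *; split; lra.
move=> q0 c0 p0 d0 r00.
(* Thresholds on [W]: [a1] makes minority densities at good sites small, [a2] gives [kappa >= 1],
   [a3] and [a4] make the coefficients of the minority density and of the bad-site count
   positive. *)
pose a1 := delta / (r0 * (p / 6) ^+ 2); pose a2 := 2 * q / r0.
pose a3 := 2 * (2 * c + `|t|) / r0; pose a4 := 4 * (2 * c ^+ 2 + 4 * q ^+ 2 / r0) / delta.
have p6 : 0 < (p / 6) ^+ 2 by rewrite exprn_gt0 // divr_gt0.
have a10 : 0 <= a1 by rewrite divr_ge0 // ltW // mulr_gt0.
have a20 : 0 <= a2 by rewrite divr_ge0 ?mulr_ge0 // ltW.
have a30 : 0 <= a3 by rewrite divr_ge0 ?(ltW r00) // mulr_ge0 // addr_ge0 // mulr_ge0 // ltW.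
have a40 : 0 <= a4.
  rewrite divr_ge0 ?(ltW d0) // mulr_ge0 // addr_ge0 //; first by rewrite mulr_ge0 // sqr_ge0.
  by rewrite divr_ge0 ?(ltW r00) // mulr_ge0 // sqr_ge0.
exists (1 + a1 + a2 + a3 + a4); split; first by rewrite !addr_ge0.
move=> W /(aux _ _ _ _ _ a10 a20 a30 a40) [W0 h1 h2 h3 h4].
have Wr : 0 < W * r0 by rewrite mulr_gt0.
have h3' : 2 * (2 * c + `|t|) < W * r0 by rewrite -ltr_pdivrMr.
split => //.
- by rewrite ler_pdivlMr ?mul1r ?mulr_gt0 // -ler_pdivrMr.
- by rewrite -mulrA -ler_pdivrMr // mulr_gt0.
- have -> : delta / 4 - 2 * c ^+ 2 / W - 2 * (q / (W * r0 / (2 * q))) =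
     delta / 4 - (2 * c ^+ 2 + 4 * q ^+ 2 / r0) / W by field; rewrite !gt_eqF.
  rewrite subr_gt0 ltr_pdivrMr //; move: h4; rewrite /a4 ltr_pdivrMr //.
  move: (2 * c ^+ 2 + _) => z h; have -> : delta / 4 * W = (W * delta) / 4 by field.
  by rewrite ltr_pdivlMr // mulrC.
- have -> : q * (W * r0 / (2 * q)) = W * r0 / 2 by field; rewrite gt_eqF.
  by move: h3'; move: (W * r0) `|t| => z w; lra.
Qed.

Lemma energy_dichotomy {R : realType} (t q c p eta eps : R) :
  0 < q -> 0 < c -> 0 < p -> p <= 1 -> 0 < eta -> 20 * eps <= p ^+ 4 / 8 ->
  exists W0 : R, 0 <= W0 /\ forall W, W0 <= W ->
  forall n (V : 'M[R[i]]_n) (l : 'I_n -> R) (T : rel 'I_n) (gu gd : 'M[R[i]]_n),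
  unitary V -> (forall x y, specf V l x y = rc (t * (x == y)%:R - (T x y)%:R)) ->
  (forall k, `|l k| <= c) -> symmetric T -> (forall x, \sum_y (T x y)%:R = q) ->
  (forall x, p ^+ 2 <= Re (negproj V l x x)) ->
  (forall x y, T x y -> p <= Re (negproj V l x y)) ->
  (forall y, \sum_(k | `|l k| < eta) sq (V k y) <= eps) ->
  density_matrix gu -> density_matrix gd ->
  let E := Re (\tr (specf V l *m (gu + gd))) + W * (\sum_x Re (gu x x) * Re (gd x x)) in
  \sum_(k | l k < 0) l k <= E /\
  (E = \sum_(k | l k < 0) l k -> exists A : pred 'I_n,
    [/\ forall x y, T x y -> A x -> A y, forall x, ~~ A x -> Re (gu x x) <= 0
      & forall x, A x -> Re (gd x x) <= 0]).
Proof.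
move=> q0 c0 p0 p1 eta0 heps.
(* At a good site the gain and the density of states each contribute at most p^4/8 to |D|^2, which
   makes |D| <= p^2/2 entrywise. The total density there is then at least p^2/2, and the majority
   spin has at least half of it, [r0]. *)
pose r0 := p ^+ 2 / 4; pose delta := eta * (p ^+ 4 / 16).
have r00 : 0 < r0 by rewrite divr_gt0 // exprn_gt0.
have d0 : 0 < delta by rewrite mulr_gt0 // divr_gt0 // exprn_gt0.
have [W0 [W00 hW0]] := coupling_threshold t q c p delta r0 q0 c0 p0 d0 r00.
exists W0; split=> // W /hW0 [Wp k1 hdel co1 co2] n V l T gu gd u hK lc sT hq hPd hPe hdos du dd E.
set P := negproj V l in hPd hPe; set D := gu + gd - P.
pose s x := Re (gu x x) * Re (gd x x).
pose B x := (delta <= gain V l D x) || (delta <= W * s x).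
pose Au x := ~~ B x && (Re (gd x x) <= Re (gu x x)).
pose Ad x := ~~ B x && (Re (gu x x) < Re (gd x x)).
have Re0 (g : 'M[R[i]]_n) x : density_matrix g -> 0 <= Re (g x x) by move=> dg; exact: psd_diag dg.1.
have s0 x : 0 <= W * s x by rewrite !mulr_ge0 ?Re0 // ltW.
have entry x y : ~~ B x -> sq (D y x) <= (p ^+ 2 / 2) ^+ 2.
  rewrite negb_or -!ltNge => /andP[hg _].
  have := entry_le_gain V l eta eps 10 D x y u eta0 (hdos y)
    (deviation_col_bound gu gd P x du dd (negproj_density V l u)).
  move=> h; apply: (le_trans h).
  have : gain V l D x / eta <= p ^+ 4 / 16 by rewrite ler_pdivrMr // mulrC ltW.
  have -> : (p ^+ 2 / 2) ^+ 2 = p ^+ 4 / 4 by field.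
  by move: heps; move: (gain V l D x / eta) (p ^+ 4) => a b; lra.
have hsum x : ~~ B x -> p ^+ 2 / 2 <= Re (gu x x) + Re (gd x x).
  by move=> nB; apply: (good_site_density gu gd P p x p0 (hPd x)); exact: entry.
have hu x : Au x -> ~~ B x /\ r0 <= Re (gu x x).
  move=> /andP[nB le]; split=> //; have := hsum x nB; rewrite /r0.
  by move: le; move: (Re (gu x x)) (Re (gd x x)) (p ^+ 2) => a b z; lra.
have hd x : Ad x -> ~~ B x /\ r0 <= Re (gd x x).
  move=> /andP[nB le]; split=> //; have := hsum x nB; rewrite /r0.
  by move: le; move: (Re (gu x x)) (Re (gd x x)) (p ^+ 2) => a b z; lra.
have small (a b : R) : r0 <= a -> 0 <= b -> W * (a * b) < delta -> b <= (p / 6) ^+ 2.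
  move=> ra b0 h; have : W * r0 * b <= W * r0 * (p / 6) ^+ 2.
    apply: le_trans hdel; apply: le_trans (ltW h); rewrite -mulrA.
    by rewrite ler_wpM2l ?(ltW Wp) // ler_wpM2r.
  by rewrite ler_pM2l // mulr_gt0.
have smallu x : Ad x -> Re (gu x x) <= (p / 6) ^+ 2.
  move=> Adx; have [nB rx] := hd x Adx; apply: (small _ _ rx); first exact: Re0.
  by move: nB; rewrite negb_or -!ltNge => /andP[_]; rewrite /s [X in W * X]mulrC.
have smalld x : Au x -> Re (gd x x) <= (p / 6) ^+ 2.
  move=> Aux; have [nB rx] := hu x Aux; apply: (small _ _ rx); first exact: Re0.
  by move: nB; rewrite negb_or -!ltNge => /andP[_].
have cover x : [|| B x, Au x | Ad x].
  by rewrite /Au /Ad; case: (B x) => //=; case: leP.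
have excl x y : T x y -> Au x -> Ad y -> False.
  move=> Txy Aux Ady; have [nB _] := hu x Aux.
  apply: (good_edge_colour gu gd P p x y p0 p1 _ du dd (entry x y nB) (smallu y Ady) (smalld x Aux)).
  by apply: hPe; rewrite sT.
have Tu x y : T x y -> Au x -> Au y || B y.
  move=> Txy Aux; case/or3P: (cover y) => [->|->|Ady]; rewrite ?orbT //.
  by case: (excl x y Txy Aux Ady).
have Td x y : T x y -> Ad x -> Ad y || B y.
  move=> Txy Adx; case/or3P: (cover y) => [->|Auy|->]; rewrite ?orbT //.
  by case: (excl y x _ Auy Adx); rewrite sT.
have hB x : B x -> delta <= gain V l D x + W * s x.
  move=> /orP[h|h]; apply: (le_trans h); first by rewrite lerDl.
  by rewrite lerDr gain_ge0.
have disj x : Au x -> ~~ Ad x.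
  by move=> /andP[_ h]; rewrite /Ad ltNge h andbF.
have gap := energy_gap V l T t q c W delta _ r0 gu gd B Au Ad u hK lc c0 Wp k1 sT hq du dd hB hu hd disj cover Tu Td.
rewrite -subr_ge0 in gap; rewrite -/E.
have b0 : 0 <= \sum_x (B x)%:R :> R by apply: sumr_ge0 => x _; rewrite ler0n.
have tu0 : 0 <= \sum_(x | Ad x) Re (gu x x) by apply: sumr_ge0 => x _; exact: Re0.
have td0 : 0 <= \sum_(x | Au x) Re (gd x x) by apply: sumr_ge0 => x _; exact: Re0.
have m1 := mulr_ge0 (ltW co1) b0; have m2 := mulr_ge0 (ltW co2) (addr_ge0 tu0 td0).
rewrite subr_ge0 in gap; split.
  by rewrite -subr_ge0; apply: le_trans gap; exact: addr_ge0.
(* At equality both nonnegative terms of the gap vanish, and their coefficients are strictly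
   positive. *)
move=> eE; rewrite -/E eE subrr in gap.
have z1 : \sum_x (B x)%:R = 0 :> R.
  apply/eqP; rewrite eq_le b0 andbT -(pmulr_rle0 _ co1).
  by apply: le_trans gap; rewrite lerDl.
have z2 : \sum_(x | Ad x) Re (gu x x) + \sum_(x | Au x) Re (gd x x) <= 0.
  by rewrite -(pmulr_rle0 _ co2); apply: le_trans gap; rewrite lerDr.
have nB x : ~~ B x.
  move/eqP: z1; rewrite psumr_eq0 => [/allP /(_ x)|z _]; last exact: ler0n.
  by rewrite mem_index_enum => /(_ isT) /=; rewrite pnatr_eq0 eqb0.
exists Au; split.
- by move=> x y Txy /(Tu x y Txy); rewrite (negbTE (nB y)) orbF.
- move=> x nA; have Adx : Ad x by have := cover x; rewrite (negbTE (nB x)) (negbTE nA).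
  apply: le_trans z2; rewrite (bigD1 x) //= -addrA lerDl addr_ge0 //.
  by apply: sumr_ge0 => y _; exact: Re0.
- move=> x Aux; apply: le_trans z2; rewrite [X in _ + X](bigD1 x) //= addrCA lerDl addr_ge0 //.
  by apply: sumr_ge0 => y _; exact: Re0.
Qed.

(** * The periodic lattice *)

(** The pairs [u] label the oriented unit steps from a site: [true] is forward along the axis,
    [false] backward, both with wrap-around. *)
Definition nb {d L} (u : bool * 'I_d) (x : lattice d L) : lattice d L :=
  [ffun j => if j == u.2 then (if u.1 then ordS (x j) else ord_pred (x j)) else x j].

Lemma val_ordS L (a : 'I_L) : ordS a = (if a.+1 == L then 0 else a.+1)%N :> nat.
Proof.
rewrite /=; case: eqP => [->|ne]; first by rewrite modnn.
by rewrite modn_small // ltn_neqAle ltn_ord andbT; apply/eqP.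
Qed.

Lemma val_ord_pred L (a : 'I_L) : ord_pred a = (if a == 0 :> nat then L.-1 else a.-1)%N :> nat.
Proof.
rewrite /=; have := ltn_ord a; case: eqP => [->|ne] aL; first by rewrite add0n modn_small // prednK // (leq_ltn_trans _ aL).
have -> : ((a + L).-1 = a.-1 + L)%N by lia.
by rewrite modnDr modn_small //; lia.
Qed.

Lemma cdistC L (a b : 'I_L) : cdist L a b = cdist L b a.
Proof. by rewrite /cdist addnC. Qed.

Lemma l1distC d L (x y : lattice d L) : l1dist d L x y = l1dist d L y x.
Proof. by apply: eq_bigr => i _; rewrite cdistC. Qed.

Lemma cdist_eq0 L (a b : 'I_L) : (cdist L a b == 0%N) = (a == b).
Proof.
rewrite /cdist -val_eqE /=; have := ltn_ord a; have := ltn_ord b.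
by move: (val a) (val b) => a' b' hb ha; lia.
Qed.

Lemma cdist_ordS L (a b : 'I_L) : cdist L (ordS a) (ordS b) = cdist L a b.
Proof.
rewrite /cdist !val_ordS; have := ltn_ord a; have := ltn_ord b.
by move: (nat_of_ord a) (nat_of_ord b) => a' b' hb ha; case: eqP => e1; case: eqP => e2; lia.
Qed.

Lemma cdist_eq1 L (a b : 'I_L) : (2 < L)%N ->
  (cdist L a b == 1%N) = (b == ordS a) || (b == ord_pred a).
Proof.
move=> L2; rewrite /cdist -!(inj_eq (@ord_inj _)) val_ordS val_ord_pred /=; have := ltn_ord a; have := ltn_ord b.
move: (nat_of_ord a) (nat_of_ord b) => a' b' hb ha.
by case: (eqVneq a'.+1 L) => e1; case: (eqVneq a' 0%N) => e2; lia.
Qed.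

Lemma l1dist_nb d L (u : bool * 'I_d) (x : lattice d L) : (2 < L)%N -> l1dist d L x (nb u x) = 1%N.
Proof.
move=> L2; rewrite /l1dist (bigD1 u.2) //= big1 => [|j /negbTE ne]; last first.
  by rewrite ffunE ne; apply/eqP; rewrite cdist_eq0.
by rewrite addn0 ffunE eqxx; apply/eqP; rewrite cdist_eq1 //; case: u.1; rewrite eqxx ?orbT.
Qed.

(** For [L = 2] the forward and backward neighbours along an axis coincide; [2 < L] is what gives
    every site degree 2d. *)
Lemma nb_inj d L (x : lattice d L) : (2 < L)%N -> injective (fun u => nb u x).
Proof.
move=> L2 [b i] [b' i'] /ffunP e.
have nS (a : 'I_L) : (ordS a == a) = false.
  by rewrite -(inj_eq (@ord_inj _)) val_ordS /=; have := ltn_ord a; case: (eqVneq a.+1 L); lia.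
have nP (a : 'I_L) : (ord_pred a == a) = false.
  by rewrite -(inj_eq (@ord_inj _)) val_ord_pred /=; have := ltn_ord a; case: (eqVneq (a : nat) 0%N); lia.
have nSP (a : 'I_L) : (ordS a == ord_pred a) = false.
  by rewrite -(inj_eq (@ord_inj _)) val_ordS val_ord_pred /=; have := ltn_ord a;
  case: (eqVneq (a : nat) 0%N); case: (eqVneq a.+1 L); lia.
have ei : i = i'.
  apply/eqP; apply/negP => /negP ne; move: (e i); rewrite !ffunE /= eqxx (negbTE ne).
  by case: b {e} => /eqP; rewrite ?nS ?nP.
move: (e i); rewrite !ffunE /= -ei eqxx.
by case: b {e}; case: b' => // /eqP; rewrite ?nSP // eq_sym nSP.
Qed.

Lemma l1dist_eq1P d L (x y : lattice d L) : (2 < L)%N -> l1dist d L x y = 1%N -> exists u, y = nb u x.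
Proof.
move=> L2 /eqP; rewrite /l1dist => /sum_nat_eq1 [i [_ /eqP hi hj]].
move: hi; rewrite cdist_eq1 // => hi.
have hj' j : j != i -> y j = x j.
  by move=> ne; have /eqP := hj j ne isT; rewrite cdist_eq0 => /eqP.
exists (y i == ordS (x i), i); apply/ffunP => j; rewrite ffunE /=.
case: (eqVneq j i) => [->|/hj' //].
by move: hi; case: eqP => [->|_ /= /eqP].
Qed.

Lemma sum_neighbours (V : nmodType) d L (x : lattice d L) (F : lattice d L -> V) : (2 < L)%N ->
  \sum_(y | l1dist d L x y == 1%N) F y = \sum_u F (nb u x).
Proof.
move=> L2.
transitivity (\sum_(u in [set: bool * 'I_d]) F (nb u x)); last by apply: eq_bigl => u; rewrite inE.
rewrite -(big_imset (h := fun u => nb u x) F) /=; last by move=> u v _ _; exact: nb_inj.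
apply: eq_bigl => y; apply/eqP/imsetP => [/(l1dist_eq1P _ _ _ _ L2)[u ->]|[u _ ->]].
  by exists u; rewrite ?inE.
exact: l1dist_nb.
Qed.

Lemma l1dist_shift d L (i : 'I_d) (x y : lattice d L) :
  l1dist d L (nb (true, i) x) (nb (true, i) y) = l1dist d L x y.
Proof. by apply: eq_bigr => j _; rewrite !ffunE /=; case: eqP => // _; rewrite cdist_ordS. Qed.

Lemma nbK d L (i : 'I_d) b : cancel (@nb d L (b, i)) (@nb d L (~~ b, i)).
Proof.
move=> x; apply/ffunP => j; rewrite !ffunE /=.
by case: eqP => // _; case: b; rewrite /= ?ordSK ?ord_predK.
Qed.

(** Shifts only relate parallel edges; exchanging two axes relates edges of different directions. *)
Definition swapc {d L} (i j : 'I_d) (x : lattice d L) : lattice d L := [ffun k => x (tperm i j k)].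

Lemma swapcK d L (i j : 'I_d) : involutive (@swapc d L i j).
Proof. by move=> x; apply/ffunP => k; rewrite !ffunE tpermK. Qed.

Lemma l1dist_swap d L (i j : 'I_d) (x y : lattice d L) :
  l1dist d L (swapc i j x) (swapc i j y) = l1dist d L x y.
Proof.
rewrite /l1dist [RHS](reindex_inj (@perm_inj _ (tperm i j))).
by apply: eq_bigr => k _; rewrite !ffunE.
Qed.

Lemma nbC d L (u v : bool * 'I_d) (x : lattice d L) : u.1 = v.1 -> nb u (nb v x) = nb v (nb u x).
Proof.
move=> e; apply/ffunP => k; rewrite !ffunE e.
by case: eqP => // _; case: eqP.
Qed.

Lemma swap_nb d L (i j : 'I_d) b (a : 'I_L) :
  swapc i j (nb (b, i) [ffun=> a]) = nb (b, j) [ffun=> a].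
Proof.
apply/ffunP => k; rewrite !ffunE /=; congr (if _ then _ else _).
by rewrite (can2_eq (tpermK i j) (tpermK i j)) tpermL.
Qed.

Lemma iter_nb d L (i : 'I_d) k (x : lattice d L) j :
  iter k (nb (true, i)) x j = (if j == i then (x j + k) %% L else x j)%N :> nat.
Proof.
elim: k => [|k IH] /=; first by rewrite addn0; case: eqP => // _; rewrite modn_small.
rewrite ffunE /=; case: eqP IH => //= _ IH.
by rewrite -addn1 IH modnDml -addnA addn1.
Qed.

Lemma shift_invariant_const (U : Type) d L (f : lattice d L -> U) :
  (forall i x, f (nb (true, i) x) = f x) -> forall x y, f x = f y.
Proof.
move=> hf x y.
pose z (s : seq 'I_d) : lattice d L := [ffun j => if j \in s then y j else x j].
have hz s : f (z s) = f x.
  elim: s => [|i s IH]; first by congr f; apply/ffunP => j; rewrite ffunE in_nil.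
  rewrite -IH; have it k w : f (iter k (nb (true, i)) w) = f w.
    by elim: k => //= k <-; rewrite hf.
  (* The number of forward steps is the difference of the coordinates modulo L, written without
     truncated subtraction. *)
  rewrite -(it (y i + (L - z s i))%N (z s)); congr f.
  apply/ffunP => j; apply: val_inj; rewrite /= iter_nb !ffunE in_cons.
  case: (eqVneq j i) => [->|//] /=.
  have h := ltn_ord (if i \in s then y i else x i).
  by rewrite addnCA subnKC ?(ltnW h) // modnDr modn_small.
have <- : z (enum 'I_d) = y by apply/ffunP => j; rewrite ffunE mem_enum.
by rewrite hz.
Qed.

Lemma card_box d L (F : 'I_d -> pred 'I_L) :
  #|[pred x : lattice d L | [forall i, F i (x i)]]| = (\prod_i #|F i|)%N.
Proof.
have -> : (\prod_i #|F i| = \prod_i \sum_(a in F i) 1)%N by apply: eq_bigr => i _; rewrite sum1_card.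
rewrite bigA_distr_big_dep /= -sum1_card; apply: eq_big => [x|x _]; last by rewrite big1.
by apply/idP/idP => [/forallP h|/familyP h]; [apply/familyP|apply/forallP] => i; exact: h.
Qed.

(** * Quadratic forms and trial vectors *)

Lemma sum_sq_unitary_row {R : realType} {n} (V : 'M[R[i]]_n) k : unitary V -> \sum_x sq (V k x) = 1.
Proof.
move=> [_ v]; have : Re ((V *m adjmx V) k k) = 1 by rewrite v mxE eqxx.
by rewrite mxE Re_sum => <-; apply: eq_bigr => x _; rewrite adjmxE Re_mul_conj.
Qed.

Lemma specf_form {R : realType} {n} (V : 'M[R[i]]_n) (f : 'I_n -> R) (w : 'I_n -> R[i]) :
  \sum_x \sum_y Re (Num.conj (w x) * specf V f x y * w y) = \sum_k f k * sq (\sum_y V k y * w y).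
Proof.
transitivity (\sum_x \sum_y \sum_k f k * Re (Num.conj (V k x * w x) * (V k y * w y))).
  apply: eq_bigr => x _; apply: eq_bigr => y _; rewrite specfE mulr_sumr mulr_suml Re_sum.
  apply: eq_bigr => k _; rewrite rmorphM -ReZ; congr Re; ring.
under eq_bigr => x _ do rewrite exchange_big /=.
rewrite exchange_big /=; apply: eq_bigr => k _.
rewrite -Re_mul_conj [X in Re X]mulrC rmorph_sum /= mulr_suml Re_sum mulr_sumr; apply: eq_bigr => x _.
by rewrite mulr_sumr Re_sum mulr_sumr.
Qed.

Lemma Re_conj_mul_le {R : realType} (a b : R[i]) : 2 * `|Re (Num.conj a * b)| <= sq a + sq b.
Proof.
have -> : 2 * `|Re (Num.conj a * b)| = `|2 * Re (Num.conj a * b)| by rewrite normrM ger0_norm.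
case: a => a1 a2; case: b => b1 b2; rewrite /sq /= ler_norml.
have := sqr_ge0 (a1 - b1); have := sqr_ge0 (a2 - b2).
have := sqr_ge0 (a1 + b1); have := sqr_ge0 (a2 + b2).
by move=> *; apply/andP; split; lra.
Qed.

(** Evaluates the quadratic form at the k-th eigenvector and applies 2|ab| <= |a|^2 + |b|^2 on each
    edge. The bound is uniform in the volume and serves as the constant [c] of the energy
    estimates. *)
Lemma eigenvalue_bound {R : realType} {n} (V : 'M[R[i]]_n) (l : 'I_n -> R) (T : rel 'I_n) (t q : R) k :
  unitary V -> (forall x y, specf V l x y = rc (t * (x == y)%:R - (T x y)%:R)) ->
  symmetric T -> (forall x, \sum_y (T x y)%:R = q) -> `|l k| <= `|t| + q.
Proof.
move=> u hK sT hq.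
have f1 := specf_form V l (fun x => Num.conj (V k x)).
have e j : \sum_y V j y * Num.conj (V k y) = (j == k)%:R.
  by have := u.2 => /matrixP /(_ j k); rewrite !mxE => <-; apply: eq_bigr => y _; rewrite adjmxE.
have {}f1 : l k = \sum_x \sum_y (t * (x == y)%:R - (T x y)%:R) * Re (V k x * Num.conj (V k y)).
  rewrite -[LHS]mulr1; transitivity (\sum_j l j * sq (\sum_y V j y * Num.conj (V k y))).
    rewrite (bigD1 k) //= e eqxx sq_rc expr1n big1 ?addr0 // => j /negbTE ne.
    by rewrite e ne sq0 mulr0.
  rewrite -f1; apply: eq_bigr => x _; apply: eq_bigr => y _.
  by rewrite conjCK hK mulrAC -ReZ mulrC.
have {}f1 : l k = t - \sum_x \sum_y (T x y)%:R * Re (V k x * Num.conj (V k y)).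
  have et : t = t * \sum_x sq (V k x) by rewrite (sum_sq_unitary_row V k u) mulr1.
  rewrite f1 [X in _ = X - _]et mulr_sumr -sumrB; apply: eq_bigr => x _.
  under eq_bigr do rewrite mulrBl.
  rewrite sumrB; congr (_ - _); rewrite -Re_mul_conj (bigD1 x) // eqxx mulr1 big1 /= ?addr0 // => y.
  by rewrite eq_sym => /negbTE ->; rewrite mulr0 mul0r.
have bnd : `|\sum_x \sum_y (T x y)%:R * Re (V k x * Num.conj (V k y))| <= q.
  have h := sum_edges T q (fun x => sq (V k x)) sT hq.
  rewrite (sum_sq_unitary_row V k u) mulr1 in h.
  rewrite -(ler_pM2l (ltr0n R 2)) -h.
  apply: le_trans (ler_wpM2l (ler0n R 2) (ler_norm_sum _ _ _)) _; rewrite mulr_sumr.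
  apply: ler_sum => x _; apply: le_trans (ler_wpM2l (ler0n R 2) (ler_norm_sum _ _ _)) _.
  rewrite mulr_sumr; apply: ler_sum => y _; rewrite normrM [`|_%:R|]ger0_norm ?ler0n // mulrCA.
  rewrite ler_wpM2l ?ler0n //.
  by have := Re_conj_mul_le (Num.conj (V k x)) (Num.conj (V k y)); rewrite conjCK !sq_conj.
rewrite f1; apply: le_trans (ler_normB _ _) _; rewrite lerD2l //.
Qed.

(** The trial vector [w] is a sign on [S] and 0 elsewhere. Cauchy-Schwarz on [S] bounds the squared
    overlap of [w] with an eigenvector by |S| times the mass of that eigenvector on [S]. Summed
    against [f] this gives |S| times the diagonal over [S], that is |S|^2 [m]. *)
Lemma specf_diag_lower_bound {R : realType} {n} (V : 'M[R[i]]_n) (f l' : 'I_n -> R)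
    (S : pred 'I_n) (w : 'I_n -> R) (m : R) :
  (forall k, 0 <= f k) -> (forall k, l' k <= f k) -> (forall x, Re (specf V f x x) = m) ->
  (forall x, w x ^+ 2 = (S x)%:R) ->
  \sum_x \sum_y w x * w y * Re (specf V l' x y) <= (\sum_x (S x)%:R) ^+ 2 * m.
Proof.
move=> f0 lf hm hw.
have -> : \sum_x \sum_y w x * w y * Re (specf V l' x y) = \sum_k l' k * sq (\sum_y V k y * rc (w y)).
  rewrite -specf_form; apply: eq_bigr => x _; apply: eq_bigr => y _.
  rewrite conj_rc -[in RHS]mulrA ReZ -mulrA; congr (_ * _).
  by rewrite [in RHS]mulrC ReZ.
apply: (@le_trans _ _ (\sum_k f k * ((\sum_x (S x)%:R * sq (V k x)) * \sum_x (S x)%:R))).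
  apply: ler_sum => k _; apply: (@le_trans _ _ (f k * sq (\sum_y V k y * rc (w y)))).
    by rewrite ler_wpM2r ?sq_ge0.
  rewrite ler_wpM2l //.
  have -> : \sum_y V k y * rc (w y) = \sum_y ((S y)%:R * V k y) * rc (w y).
    apply: eq_bigr => y _; have := hw y; case: (S y); first by rewrite mul1r.
    by move=> /eqP; rewrite sqrf_eq0 => /eqP ->; rewrite rmorph0 !mulr0.
  apply: (le_trans (cauchy_schwarz _ _ _ _)); rewrite le_eqVlt; apply/orP; left; apply/eqP.
  congr (_ * _); apply: eq_bigr => y _; last by rewrite sq_rc hw.
  by rewrite sqM; case: (S y); rewrite ?sq0 ?mul0r // sq_rc expr1n.
under eq_bigr do rewrite mulrA.
rewrite -mulr_suml expr2 -mulrA mulrC ler_wpM2l //; last first.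
  rewrite le_eqVlt; apply/orP; left; apply/eqP; rewrite mulr_suml.
  under eq_bigr do rewrite mulr_sumr.
  rewrite exchange_big /=; apply: eq_bigr => x _; rewrite -(hm x) specf_diag mulr_sumr.
  by apply: eq_bigr => k _; rewrite mulrCA.
by apply: sumr_ge0 => x _; rewrite ler0n.
Qed.

(** * Lattice symmetries of functions of the Laplacian *)

Definition nnrel d L : rel 'I_(nsites d L) := fun i j => l1dist d L (site d L i) (site d L j) == 1%N.
Definition idx {d L} (x : lattice d L) : 'I_(nsites d L) := enum_rank x.

Lemma site_idx d L (x : lattice d L) : site d L (idx x) = x.
Proof. exact: enum_rankK. Qed.
Lemma idx_site d L (i : 'I_(nsites d L)) : idx (site d L i) = i.
Proof. exact: enum_valK. Qed.

Lemma sum_sites (V : nmodType) d L (F : 'I_(nsites d L) -> V) : \sum_i F i = \sum_x F (idx x).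
Proof.
apply: reindex; exists (site d L) => [x _|i _]; [exact: site_idx|exact: idx_site].
Qed.

Lemma nnrel_sym d L : symmetric (nnrel d L).
Proof. by move=> i j; rewrite /nnrel l1distC. Qed.

Lemma sum_nnrel {R : nzRingType} d L i (F : 'I_(nsites d L) -> R) : (2 < L)%N ->
  \sum_j (nnrel d L i j)%:R * F j = \sum_u F (idx (nb u (site d L i))).
Proof.
move=> L2; rewrite sum_sites -(sum_neighbours _ _ _ _ (fun x => F (idx x)) L2) [RHS]big_mkcond.
by apply: eq_bigr => x _; rewrite /nnrel site_idx; case: eqP => _; rewrite ?mul1r ?mul0r.
Qed.

Lemma nnrel_degree {R : realType} d L i : (2 < L)%N ->
  \sum_j (nnrel d L i j)%:R = (2 * d)%:R :> R.
Proof.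
move=> L2; under eq_bigr do rewrite -[_%:R]mulr1.
by rewrite sum_nnrel // sumr_const card_prod card_bool card_ord.
Qed.

Lemma nnrel_irr d L i : nnrel d L i i = false.
Proof. by rewrite /nnrel /l1dist big1 // => j _; apply/eqP; rewrite cdist_eq0. Qed.

Lemma Kmu_entry {R : realType} d L (mu : R) i j :
  cplx (Kmu R d L mu) i j = rc (((2 * d)%:R - mu) * (i == j)%:R - (nnrel d L i j)%:R).
Proof.
rewrite !mxE /nnrel; congr (real_complex R _).
by case: (i == j); case: (_ == 1%N); rewrite ?mulr1n ?mulr0n ?mulr1 ?mulr0; ring.
Qed.

Lemma specf_isometry {R : realType} d L (V : 'M[R[i]]_(nsites d L)) l (t : R)
    (phi : R -> R) (s : lattice d L -> lattice d L) x y : unitary V ->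
  (forall i j, specf V l i j = rc (t * (i == j)%:R - (nnrel d L i j)%:R)) ->
  injective s -> (forall x y, l1dist d L (s x) (s y) = l1dist d L x y) ->
  specf V (phi \o l) (idx (s x)) (idx (s y)) = specf V (phi \o l) (idx x) (idx y).
Proof.
move=> u hK si sd.
have inj : injective (fun i => idx (s (site d L i))).
  by move=> i j /enum_rank_inj /si /enum_val_inj.
have := specf_perm V (perm inj) l phi u _ (idx x) (idx y).
rewrite !permE !site_idx; apply=> i j.
by rewrite !hK (inj_eq perm_inj) /nnrel !permE !site_idx sd.
Qed.

Lemma nb_injective d L (u : bool * 'I_d) : injective (@nb d L u).
Proof. by case: u => b i; exact: can_inj (nbK d L i b). Qed.

Lemma specf_diag_const {R : realType} d L (V : 'M[R[i]]_(nsites d L)) l (t : R) (phi : R -> R) :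
  unitary V -> (forall i j, specf V l i j = rc (t * (i == j)%:R - (nnrel d L i j)%:R)) ->
  forall i j, specf V (phi \o l) i i = specf V (phi \o l) j j.
Proof.
move=> u hK i j; rewrite -(idx_site _ _ i) -(idx_site _ _ j).
apply: (shift_invariant_const _ _ _ (fun x => specf V (phi \o l) (idx x) (idx x))) => k x.
by apply: (specf_isometry _ _ _ _ t) => //; [exact: nb_injective|exact: l1dist_shift].
Qed.

(** Shifts identify parallel forward edges, axis exchanges identify directions, and hermiticity
    reverses an edge, which costs only a conjugation and hence preserves the real part. *)
Lemma specf_edge_const {R : realType} d L (V : 'M[R[i]]_(nsites d L)) l (t : R) (phi : R -> R) :
  unitary V -> (forall i j, specf V l i j = rc (t * (i == j)%:R - (nnrel d L i j)%:R)) ->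
  forall u v x y, Re (specf V (phi \o l) (idx x) (idx (nb u x))) =
                  Re (specf V (phi \o l) (idx y) (idx (nb v y))).
Proof.
move=> uV hK; set M := specf V (phi \o l).
have inv s x y : injective s -> (forall x y, l1dist d L (s x) (s y) = l1dist d L x y) ->
    M (idx (s x)) (idx (s y)) = M (idx x) (idx y) by exact: (specf_isometry _ _ _ _ t).
have fwd i : forall x y, Re (M (idx x) (idx (nb (true, i) x))) = Re (M (idx y) (idx (nb (true, i) y))).
  apply: (shift_invariant_const _ _ _ (fun x => Re (M (idx x) (idx (nb (true, i) x))))) => k x.
  rewrite (nbC _ _ (true, i) (true, k)) // inv //; [exact: nb_injective|exact: l1dist_shift].
have fwd2 i j x y : Re (M (idx x) (idx (nb (true, i) x))) = Re (M (idx y) (idx (nb (true, j) y))).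
  (* A point on the diagonal of the lattice is fixed by the axis exchange, so only the direction of
     the edge changes. *)
  pose z : lattice d L := [ffun=> x i].
  have ez : swapc i j z = z by apply/ffunP => k; rewrite !ffunE.
  rewrite (fwd i _ z) (fwd j _ z).
  have := inv (swapc i j) z (nb (true, i) z) (inv_inj (swapcK d L i j)) (l1dist_swap d L i j).
  by rewrite swap_nb ez => <-.
have all_fwd u x : exists y, Re (M (idx x) (idx (nb u x))) = Re (M (idx y) (idx (nb (true, u.2) y))).
  case: u => -[] i; first by exists x.
  exists (nb (false, i) x); rewrite [in RHS](nbK d L i false).
  by rewrite (herm_entry M (idx x) _ (specf_herm _ _)) Re_conj.
move=> u v x y; have [x' ->] := all_fwd u x; have [y' ->] := all_fwd v y.
exact: fwd2.
Qed.

(* [m.+1] is the side of the box *)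
Definition box d L m : pred (lattice d L) := fun x => [forall i, (x i < m.+1)%N].

Lemma card_ord_range L a b : (b <= L)%N -> #|[pred x : 'I_L | (a <= x < b)%N]| = (b - a)%N.
Proof.
move=> bL; rewrite -sum1_card.
rewrite (eq_bigl (fun x : 'I_L => (a <= x < b)%N)) //.
rewrite -(big_mkord (fun x => (a <= x < b)%N) (fun=> 1%N)).
rewrite (big_cat_nat _ (n := b)) //= [X in (_ + X)%N]big1_seq ?addn0; last first.
  by move=> k; rewrite mem_index_iota => /andP[/andP[_ h] /andP[h' _]]; lia.
rewrite sum1_count -size_filter.
rewrite (_ : [seq x <- index_iota 0 b | (a <= x < b)%N] = index_iota a b) ?size_iota //.
apply: (@sorted_eq _ ltn) => //.
- exact: ltn_trans.
- by move=> x y /andP[]; lia.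
- by rewrite sorted_filter ?iota_ltn_sorted //; exact: ltn_trans.
- exact: iota_ltn_sorted.
- by apply: uniq_perm; rewrite ?filter_uniq ?iota_uniq // => k; rewrite mem_filter !mem_index_iota; lia.
Qed.

(** * Lower bound on the nearest-neighbour entries of the spectral projection *)

Lemma card_box_dim d L m : (m.+1 <= L)%N -> #|box d L m| = (m.+1 ^ d)%N.
Proof.
move=> mL; have := card_box d L (fun=> [pred a : 'I_L | (0 <= a < m.+1)%N]).
rewrite prod_nat_const card_ord_range // subn0 card_ord => <-.
by apply: eq_card => x.
Qed.

Lemma sum_box {R : realType} d L m : (m.+1 <= L)%N ->
  \sum_i (box d L m (site d L i))%:R = (m.+1 ^ d)%:R :> R.
Proof.
move=> mL; rewrite sum_sites -(card_box_dim d L) // -sum1_card natr_sum [RHS]big_mkcond.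
by apply: eq_bigr => x _; rewrite site_idx -[x \in _]/(box d L m x); case: (box d L m x).
Qed.

Lemma box_nb_card d L m (u : bool * 'I_d) : (m.+1 <= L)%N ->
  (m * m.+1 ^ d.-1 <= #|[pred x | box d L m x && box d L m (nb u x)]|)%N.
Proof.
move=> mL.
(* Along the step direction one boundary layer of the box is dropped, the last for a forward and the
   first for a backward step. Only an inequality results, because a box of side L gains further
   edges by wrap-around. *)
pose F (j : 'I_d) : pred 'I_L := if j == u.2
  then (if u.1 then [pred a : 'I_L | (0 <= a < m)%N] else [pred a : 'I_L | (1 <= a < m.+1)%N])
  else [pred a : 'I_L | (0 <= a < m.+1)%N].
have <- : #|[pred x : lattice d L | [forall i, F i (x i)]]| = (m * m.+1 ^ d.-1)%N.
  rewrite card_box (bigD1 u.2) //= /F eqxx; congr (_ * _)%N.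
    by case: u.1; rewrite card_ord_range ?subn0 ?subn1 // ltnW.
  rewrite (eq_bigr (fun=> m.+1)); last by move=> j /negbTE ->; rewrite card_ord_range // subn0.
  by rewrite prod_nat_const cardC1 card_ord.
apply: subset_leq_card; apply/fintype.subsetP => x /forallP h; rewrite inE.
apply/andP; split; apply/forallP => j; have := h j; rewrite /F ?ffunE.
  by case: (j == u.2); [case: u.1|] => /andP[] /=; lia.
case: (j == u.2); [case: u.1|]; rewrite ?val_ordS ?val_ord_pred => /andP[h1 h2] //.
  by case: (eqVneq (x j).+1 L) => e //; move: h2; lia.
by case: (eqVneq (x j : nat) 0%N) => e; move: h1 h2; lia.
Qed.

Lemma box_edges {R : realType} d L m : (2 < L)%N -> (m.+1 <= L)%N ->
  (2 * d * (m * m.+1 ^ d.-1))%:R <=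
  \sum_i \sum_j (nnrel d L i j)%:R * ((box d L m (site d L i))%:R * (box d L m (site d L j))%:R) :> R.
Proof.
move=> L2 mL; under eq_bigr do rewrite sum_nnrel //.
rewrite exchange_big /=.
have -> : (2 * d * (m * m.+1 ^ d.-1))%:R = \sum_(u : bool * 'I_d) (m * m.+1 ^ d.-1)%:R :> R.
  by rewrite sumr_const card_prod card_bool card_ord natrM mulr_natl.
apply: ler_sum => u _; rewrite sum_sites.
apply: (@le_trans _ _ (#|[pred x | box d L m x && box d L m (nb u x)]|%:R)).
  by rewrite ler_nat box_nb_card.
rewrite -sum1_card natr_sum big_mkcond; apply: ler_sum => x _.
by rewrite !site_idx -[x \in _]/(box d L m x && box d L m (nb u x)); case: (box d L m x); case: (box d L m (nb u x)); rewrite /= ?mulr1 ?mulr0.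
Qed.

Definition parity {d L} (x : lattice d L) : bool := odd (\sum_i x i)%N.

(** Wrapping around changes a coordinate by L - 1, which is odd because L is even. Hence the
    periodic lattice is bipartite. *)
Lemma parity_nb d L (u : bool * 'I_d) (x : lattice d L) : ~~ odd L -> parity (nb u x) = ~~ parity x.
Proof.
move=> eL; rewrite /parity (bigD1 u.2) //= [in RHS](bigD1 u.2) //= !oddD.
rewrite (eq_bigr (fun i => x i : nat)); last by move=> i /negbTE ne; rewrite ffunE ne.
rewrite -addNb; congr (_ (+) _); rewrite ffunE eqxx.
have := ltn_ord (x u.2); case: u.1; rewrite ?val_ordS ?val_ord_pred.
  case: (eqVneq (x u.2).+1 L) => e h //; rewrite -[RHS]/(odd (x u.2).+1) e.
  exact/esym/negbTE.
case: (eqVneq (x u.2 : nat) 0%N) => e h; last by move: e; case: (nat_of_ord _) => //= k _; rewrite negbK.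
rewrite e in h *; move: eL; rewrite -{1}(prednK h) /= negbK => -> //.
Qed.

(** Diagonal entries of K P = -N and of K = M - N. For t < 0 the second combines with P_ii <= 1 into
    t P_ii + N_ii >= t + N_ii = M_ii, which replaces the lower bound N_ii available for t >= 0. *)
Lemma negproj_edge_sum {R : realType} {n} (V : 'M[R[i]]_n) (l : 'I_n -> R) (T : rel 'I_n) (t : R) i :
  unitary V -> (forall x y, specf V l x y = rc (t * (x == y)%:R - (T x y)%:R)) -> T i i = false ->
  let P := negproj V l in
  let N := specf V (fun k => if l k < 0 then - l k else 0) in
  let M := specf V (fun k => if l k < 0 then 0 else l k) in
  \sum_j (T i j)%:R * Re (P i j) = t * Re (P i i) + Re (N i i) /\ Re (M i i) - Re (N i i) = t.
Proof.
move=> u hK Tii P N M; split.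
  have e : specf V l *m P = - N.
    rewrite /P /negproj (specfM _ _ _ u); apply/matrixP => x y; rewrite [RHS]mxE !specfE -sumrN.
    apply: eq_bigr => k _; rewrite -mulNr -rmorphN; congr (real_complex R _ * _).
    by case: ltP => _ /=; rewrite ?mulr1 ?opprK ?mulr0 ?oppr0.
  have : Re ((specf V l *m P) i i) = - Re (N i i) by rewrite e mxE ReN.
  rewrite mxE Re_sum.
  under eq_bigr => j _ do rewrite hK ReZ (herm_entry P j i (specf_herm _ _)) Re_conj mulrBl.
  rewrite sumrB => h.
  have -> : t * Re (P i i) = \sum_j t * (i == j)%:R * Re (P i j).
    rewrite (bigD1 i) // eqxx mulr1 big1 /= ?addr0 // => j.
    by rewrite eq_sym => /negbTE ->; rewrite mulr0 mul0r.
  by rewrite -[Re (N i i)]opprK -h; ring.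
have : Re (specf V l i i) = t by rewrite hK eqxx Tii /= mulr1 subr0.
rewrite 3!specf_diag => <-; rewrite -sumrB; apply: eq_bigr => k _; rewrite -mulrBl.
by case: ltP => _; rewrite ?sub0r ?opprK ?subr0.
Qed.

(** In a large box the number of oriented edges per site tends to 2d, which exceeds |t|; a side with
    m (2d - |t|) > 2d is enough. *)
Lemma box_side_exists {R : realType} (d : nat) (t : R) : (0 < d)%N -> `|t| < (2 * d)%:R ->
  exists m : nat, 0 < (2 * d * (m * m.+1 ^ d.-1))%:R - `|t| * (m.+1 ^ d)%:R.
Proof.
move=> d0 ht; set q : R := (2 * d)%:R in ht *.
have qt : 0 < q - `|t| by rewrite subr_gt0.
exists (Num.bound (q / (q - `|t|))); set m := Num.bound _.
have hm : q / (q - `|t|) < m%:R by apply: archi_boundP; rewrite divr_ge0 ?ler0n // ltW.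
rewrite ltr_pdivrMr // in hm.
have e : (m.+1 ^ d = m.+1 * m.+1 ^ d.-1)%N by rewrite -expnS prednK.
rewrite e natrM [(m * _)%:R]natrM [(m.+1 * _)%:R]natrM -/q -natr1.
have r0 : 0 < (m.+1 ^ d.-1)%:R :> R by rewrite ltr0n expn_gt0.
have -> : q * (m%:R * (m.+1 ^ d.-1)%:R) - `|t| * ((m%:R + 1) * (m.+1 ^ d.-1)%:R) =
  (m.+1 ^ d.-1)%:R * (m%:R * (q - `|t|) - `|t|) by ring.
by rewrite mulr_gt0 // subr_gt0; apply: lt_trans hm; rewrite -subr_gt0.
Qed.

(* By symmetry all nearest-neighbour entries of [P] are equal, so their common value is read off
   the diagonal of [T P]; a box indicator (staggered if [t < 0]) tests that diagonal. *)
Lemma negproj_edge_lower_bound {R : realType} (d : nat) (t : R) : (0 < d)%N -> `|t| < (2 * d)%:R ->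
  exists (p : R) (m0 : nat), [/\ 0 < p, p <= 1 &
  forall L (V : 'M[R[i]]_(nsites d L)) l, ~~ odd L -> (2 < L)%N -> (m0 <= L)%N -> unitary V ->
    (forall i j, specf V l i j = rc (t * (i == j)%:R - (nnrel d L i j)%:R)) ->
    forall i j, nnrel d L i j -> p <= Re (negproj V l i j)].
Proof.
move=> d0 ht; have [m hm] := box_side_exists d t d0 ht.
set q : R := (2 * d)%:R in ht *.
set b := (_ - _) in hm; set s : R := (m.+1 ^ d)%:R in b hm.
have q0 : 0 < q by rewrite ltr0n muln_gt0.
have s1 : 1 <= s by rewrite ler1n expn_gt0.
have s0 : 0 < s by apply: lt_le_trans s1.
(* Comes from b <= s^2 N_ii <= s^2 q P_ij, with M in place of N when t < 0. Here [s] counts the box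
   sites and [b] bounds the trial form from below. *)
exists (b / (s ^+ 2 * q)), m.+1; split.
- by rewrite divr_gt0 // mulr_gt0 // exprn_gt0.
- rewrite ler_pdivrMr ?mul1r; last by rewrite mulr_gt0 // exprn_gt0.
  apply: (@le_trans _ _ (s * q)); last by rewrite ler_pM2r // expr2 ler_peMr // ltW.
  rewrite /b; apply: (@le_trans _ _ (2 * d * (m * m.+1 ^ d.-1))%:R).
    by rewrite gerBl mulr_ge0 // ltW.
  have e : (m.+1 ^ d = m.+1 * m.+1 ^ d.-1)%N by rewrite -expnS prednK.
  by rewrite natrM mulrC ler_pM2r // /s ler_nat e leq_mul2r leqnSn orbT.
move=> L V l eL L2 mL u hK i j Tij.
have Tq := sum_nnrel d L.
have [eqs eqt] := negproj_edge_sum V l (nnrel d L) t i u hK (nnrel_irr d L i).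
set P := negproj V l in eqs *.
have {}eqs : q * Re (P i j) = t * Re (P i i) + Re (specf V (fun k => if l k < 0 then - l k else 0) i i).
  rewrite -eqs sum_nnrel //.
  have /(l1dist_eq1P _ _ _ _ L2) [v ev] : l1dist d L (site d L i) (site d L j) = 1%N by apply/eqP.
  rewrite (eq_bigr (fun=> Re (P i j))).
    by rewrite sumr_const card_prod card_bool card_ord mulr_natl.
  move=> w _; rewrite -[in RHS](idx_site _ _ i) -[in RHS](idx_site _ _ j) ev -{1}(idx_site _ _ i).
  exact: (specf_edge_const d L V l t (fun z => (z < 0)%R%:R)).
have dP := negproj_density V l u.
have P0 : 0 <= Re (P i i) by exact: psd_diag dP.1.
have P1 : Re (P i i) <= 1 by exact: density_diag_le1.
have S2 : \sum_i (box d L m (site d L i))%:R = s := sum_box d L m mL.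
have E2 := @box_edges R d L m L2 mL.
have sumd (F : 'I_(nsites d L) -> R) x : \sum_y (x == y)%:R * F y = F x.
  rewrite (bigD1 x) // eqxx mul1r big1 /= ?addr0 // => y.
  by rewrite eq_sym => /negbTE ->; rewrite mul0r.
have diag (S : 'I_(nsites d L) -> R) : (forall x, S x * S x = (box d L m (site d L x))%:R) ->
    \sum_x \sum_y S x * S y * (t * (x == y)%:R) = t * s.
  move=> hS; rewrite -S2 mulr_sumr; apply: eq_bigr => x _; rewrite -hS.
  rewrite -(sumd (fun y => S x * S y) x) mulr_sumr; apply: eq_bigr => y _; ring.
have form_bound : 0 <= t -> b <= \sum_x \sum_y (box d L m (site d L x))%:R *
    (box d L m (site d L y))%:R * ((nnrel d L x y)%:R - t * (x == y)%:R).
  move=> t0; under eq_bigr => x _ do under eq_bigr => y _ do rewrite mulrBr.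
  under eq_bigr => x _ do rewrite sumrB; rewrite sumrB diag; last first.
    by move=> x; case: (box _ _ _ _); rewrite ?mulr1 ?mulr0.
  rewrite /b ger0_norm // lerB //; apply: (le_trans E2).
  by apply: ler_sum => x _; apply: ler_sum => y _; rewrite mulrC.
(* The sublattice sign turns -T into +T on the edges of the box, so K itself has the form (edges in
   the box) - |t| (sites in the box) on this vector. *)
have form_bound_staggered : t < 0 -> b <= \sum_x \sum_y
    ((-1) ^+ parity (site d L x) * (box d L m (site d L x))%:R) *
    ((-1) ^+ parity (site d L y) * (box d L m (site d L y))%:R) *
    Re (rc (t * (x == y)%:R - (nnrel d L x y)%:R)).
  move=> t0; under eq_bigr => x _ do under eq_bigr => y _ do rewrite mulrBr.
  under eq_bigr => x _ do rewrite sumrB; rewrite sumrB diag; last first.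
    move=> x; rewrite mulrACA -expr2 sqrr_sign mul1r.
    by case: (box _ _ _ _); rewrite ?mulr1 ?mulr0.
  rewrite /b ltr0_norm // mulNr opprK addrC lerD2l.
  apply: (le_trans E2); rewrite -sumrN; apply: ler_sum => x _; rewrite -sumrN; apply: ler_sum => y _.
  case Txy: (nnrel d L x y); last by rewrite mul0r mulr0 oppr0.
  have /(l1dist_eq1P _ _ _ _ L2) [v ->] : l1dist d L (site d L x) (site d L y) = 1%N by apply/eqP.
  rewrite parity_nb // mulr1 mul1r mulrACA.
  by case: (parity (site d L x)); rewrite /= ?expr0 ?expr1 ?mulN1r ?mulrN1 ?mulNr ?mul1r ?opprK.
suff : b <= s ^+ 2 * (q * Re (P i j)).
  move=> h; rewrite ler_pdivrMr; last by rewrite mulr_gt0 // exprn_gt0.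
  by rewrite mulrC -mulrA.
have s20 : 0 <= s ^+ 2 by rewrite sqr_ge0.
(* For t >= 0 the form -K tests the negative part of K; for t < 0 the form K tests its positive
   part. *)
have [t0|t0] := leP 0 t.
- pose f k := if l k < 0 then - l k else 0.
  apply: (@le_trans _ _ (s ^+ 2 * Re (specf V f i i))); last first.
    by rewrite ler_wpM2l // eqs lerDr mulr_ge0.
  rewrite -S2; apply: le_trans (specf_diag_lower_bound V f (fun k => - l k)
      (fun i => box d L m (site d L i)) (fun i => (box d L m (site d L i))%:R) _ _ _ _ _).
  + have e x y : Re (specf V (fun k => - l k) x y) = (nnrel d L x y)%:R - t * (x == y)%:R.
      have -> : specf V (fun k => - l k) x y = - specf V l x y.
        by rewrite !specfE -sumrN; apply: eq_bigr => k _; rewrite rmorphN mulNr.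
      by rewrite hK ReN opprB.
    under eq_bigr => x _ do under eq_bigr => y _ do rewrite e.
    exact: form_bound.
  + by move=> k; rewrite /f; case: ltP => // lk; rewrite oppr_ge0 ltW.
  + by move=> k; rewrite /f; case: ltP => // lk; rewrite oppr_le0.
  + by move=> x; congr Re; apply: (specf_diag_const d L V l t (fun z => if z < 0 then - z else 0)).
  + by move=> x; case: (box _ _ _ _); rewrite ?expr1n ?expr0n.
- pose f k := if l k < 0 then 0 else l k.
  apply: (@le_trans _ _ (s ^+ 2 * Re (specf V f i i))); last first.
    by rewrite ler_wpM2l // eqs -lerBlDr eqt -{1}[t]mulr1 ler_wnM2l // ltW.
  rewrite -S2; apply: le_trans (specf_diag_lower_bound V f l
      (fun i => box d L m (site d L i))
      (fun i => (-1) ^+ parity (site d L i) * (box d L m (site d L i))%:R) _ _ _ _ _).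
  + under eq_bigr => x _ do under eq_bigr => y _ do rewrite hK.
    exact: form_bound_staggered.
  + by move=> k; rewrite /f; case: ltP.
  + by move=> k; rewrite /f; case: ltP => // lk; rewrite ltW.
  + by move=> x; congr Re; apply: (specf_diag_const d L V l t (fun z => if z < 0 then 0 else z)).
  + by move=> x; rewrite exprMn sqrr_sign mul1r; case: (box _ _ _ _); rewrite ?expr1n ?expr0n.
Qed.

(** * Density of states *)

Lemma sum_inj_le {R : realType} (T : finType) (Q Q' : pred T) (h : T -> T) (F : T -> R) :
  injective h -> (forall x, Q x -> Q' (h x)) -> (forall x, 0 <= F x) ->
  \sum_(x | Q x) F (h x) <= \sum_(x | Q' x) F x.
Proof.
move=> hi hQ F0; rewrite [leRHS](reindex_inj hi) [leLHS]big_mkcond [leRHS]big_mkcond.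
apply: ler_sum => x _; case Qx: (Q x); first by rewrite hQ.
by case: ifP.
Qed.

Lemma modn_pred m a k : (0 < m)%N -> (a %% m = k.+1 -> a.-1 %% m = k /\ 0 < a)%N.
Proof.
move=> m0 e; have km : (k.+1 < m)%N by rewrite -e ltn_pmod.
rewrite (divn_eq a m) e addnS /=; split=> //.
by rewrite modnMDl modn_small // ltnW.
Qed.

(* Solving [t v - T v = g] for the value of [v] one step ahead in direction [i0]
   bounds the mass of [v] on one hyperplane class by those on the two previous ones. *)
Lemma transfer_step {R : realType} d L (i0 : 'I_d) (m j : nat) (t : R) (v : lattice d L -> R[i]) :
  (0 < m)%N ->
  let mass (k : nat) := \sum_(x : lattice d L | (x i0 %% m == k)%N) sq (v x) in
  let g x := rc t * v x - \sum_u v (nb u x) in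
  (j.+2 < m)%N ->
  mass j.+2 <= (4 * t ^+ 2 + 8 * d%:R + 2) * (2 * d%:R + 1) * (mass j.+1 + mass j + \sum_x sq (g x)).
Proof.
move=> m0 mass g jm; set A0 := 4 * t ^+ 2 + 8 * d%:R + 2.
have d0 : 0 <= d%:R :> R by rewrite ler0n.
have t2 := sqr_ge0 t.
have A00 : 0 <= A0 by rewrite /A0; move: t2; move: (t ^+ 2) d0 => a; lra.
pose back := nb (false, i0) : lattice d L -> lattice d L.
have massS k : 0 <= mass k by apply: sumr_ge0 => x _; exact: sq_ge0.
(* A nonzero residue forces a positive coordinate, so the backward step does not wrap around and the
   residue drops by one, whether or not [m] divides L. *)
have cls (x : lattice d L) k : (x i0 %% m = k.+1)%N -> (back x i0 %% m = k)%N.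
  move=> /(modn_pred _ _ _ m0) [e a0]; rewrite ffunE eqxx /= -[X in (X %% m)%N]/(nat_of_ord (ord_pred (x i0))) val_ord_pred.
  by rewrite gtn_eqF.
(* The equation at [back x] is solved for its forward neighbour [x]. The three parts of [A0] are
   4t^2 for the centre, 4 times the 2d neighbour terms, and 2 for the source. *)
have step x : sq (v x) <= A0 * (sq (v (back x)) + \sum_(u | u != (true, i0)) sq (v (nb u (back x))) + sq (g (back x))).
  have -> : v x = rc t * v (back x) - (\sum_(u | u != (true, i0)) v (nb u (back x))) - g (back x).
    have eb : nb (true, i0) (back x) = x := nbK d L i0 false x.
    have -> : g (back x) = rc t * v (back x) - (v x + \sum_(u | u != (true, i0)) v (nb u (back x))).
      by rewrite /g (bigD1 (true, i0)) //= eb.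
    by ring.
  have cs := cauchy_schwarz _ (fun u => u != (true, i0)) (fun=> 1) (fun u => v (nb u (back x))).
  have {}cs : sq (\sum_(u | u != (true, i0)) v (nb u (back x))) <=
      (2 * d%:R) * \sum_(u | u != (true, i0)) sq (v (nb u (back x))).
    under eq_bigr do rewrite -[v _]mul1r.
    apply: (le_trans cs); rewrite ler_wpM2r //; first by apply: sumr_ge0 => u _; exact: sq_ge0.
    rewrite -[1]/(rc 1) (eq_bigr (fun=> 1)) => [|u _]; last by rewrite sq_rc expr1n.
    apply: (@le_trans _ _ (\sum_(u : bool * 'I_d) 1)).
      by rewrite big_mkcond; apply: ler_sum => u _; case: ifP.
    by rewrite sumr_const card_prod card_bool card_ord natrM.
  have h1 := sqD (rc t * v (back x) - \sum_(u | u != (true, i0)) v (nb u (back x))) (- g (back x)).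
  have h2 := sqD (rc t * v (back x)) (- \sum_(u | u != (true, i0)) v (nb u (back x))).
  rewrite !sqN sqM sq_rc in h1 h2.
  have S0 : 0 <= \sum_(u | u != (true, i0)) sq (v (nb u (back x))) by apply: sumr_ge0 => u _; exact: sq_ge0.
  have a0 := sq_ge0 (v (back x)); have g0 := sq_ge0 (g (back x)).
  apply: (le_trans h1); move: h2 cs S0 a0 g0; rewrite /A0.
  move: (sq _) (sq (\sum_(u | u != (true, i0)) v (nb u (back x)))) (\sum_(u | u != (true, i0)) sq _)
    (sq (v (back x))) (sq (g (back x))) => p1 p2 p3 p4 p5.
  move: t2 d0; move: (t ^+ 2) (d%:R) => t' d' t0 d0 h2 cs S0 a0 g0 {h1 A00 massS cls}.
  have := mulr_ge0 t0 S0; have := mulr_ge0 t0 g0; have := mulr_ge0 d0 a0; have := mulr_ge0 d0 g0.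
  lra.
apply: (le_trans (ler_sum _ (fun x _ => step x))).
rewrite -mulr_sumr -mulrA ler_wpM2l // 2!big_split /=.
have b1 : \sum_(x : lattice d L | (x i0 %% m == j.+2)%N) sq (v (back x)) <= mass j.+1.
  apply: (sum_inj_le _ _ _ back (fun x => sq (v x))) => [||x]; [exact: nb_injective|by move=> x /eqP /cls /eqP|exact: sq_ge0].
have b3 : \sum_(x : lattice d L | (x i0 %% m == j.+2)%N) sq (g (back x)) <= \sum_x sq (g x).
  apply: (sum_inj_le _ _ _ back (fun x => sq (g x))) => [||x]; [exact: nb_injective|by []|exact: sq_ge0].
(* The remaining neighbours of [back x] are sideways, staying in class [j.+1], or one step further
   back, in class [j]. *)
have b2 : \sum_(x : lattice d L | (x i0 %% m == j.+2)%N) \sum_(u | u != (true, i0)) sq (v (nb u (back x))) <=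
    2 * d%:R * (mass j.+1 + mass j).
  rewrite exchange_big /=.
  have -> : 2 * d%:R * (mass j.+1 + mass j) = \sum_(u : bool * 'I_d) (mass j.+1 + mass j).
    by rewrite sumr_const card_prod card_bool card_ord -natrM mulr_natl.
  rewrite big_mkcond; apply: ler_sum => -[b i] _; case: ifP => [ne|_]; last by rewrite addr_ge0.
  apply: (le_trans (y := mass (if i == i0 then j else j.+1))); last first.
    by case: ifP => _; rewrite ?lerDr ?lerDl.
  apply: (sum_inj_le _ _ _ (fun x => nb (b, i) (back x)) (fun x => sq (v x))) => [||x].
  - by move=> x y /nb_injective /nb_injective.
  - move=> x /eqP /cls e; have [ei|ni] := eqVneq i i0.
      case: b ne => ne; first by rewrite ei eqxx in ne.
      by rewrite ei; apply/eqP; exact: cls.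
    by rewrite ffunE /= [i0 == i]eq_sym (negbTE ni) e.
  - exact: sq_ge0.
have k0 : 0 <= \sum_x sq (g x) by apply: sumr_ge0 => x _; exact: sq_ge0.
move: b1 b2 b3 k0 (massS j.+1) (massS j) d0.
move: (mass j.+1) (mass j) (\sum_x sq (g x)) (d%:R) => r1 r0 k d'.
move: (\sum_(x : lattice d L | (x i0 %% m == j.+2)%N) sq (v (back x)))
 (\sum_(x : lattice d L | (x i0 %% m == j.+2)%N) \sum_(u | u != (true, i0)) sq (v (nb u (back x))))
 (\sum_(x : lattice d L | (x i0 %% m == j.+2)%N) sq (g (back x))) => s1 s2 s3.
move=> b1 b2 b3 k0 r10 r00 d0 {step massS cls t2 A00}.
have := mulr_ge0 d0 k0; lra.
Qed.

Definition transfer_const {R : realType} (d : nat) (t : R) : R :=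
  3 * ((4 * t ^+ 2 + 8 * d%:R + 2) * (2 * d%:R + 1)).

Lemma transfer_const_ge1 {R : realType} (d : nat) (t : R) : 1 <= transfer_const d t.
Proof.
have d0 : 0 <= d%:R :> R by rewrite ler0n.
have t2 := sqr_ge0 t; rewrite /transfer_const; move: (t ^+ 2) (d%:R) t2 d0 => a b a0 b0.
by have := mulr_ge0 a0 b0; have := mulr_ge0 b0 b0; lra.
Qed.

(** Starting from the two empty classes, each class is bounded by the two before it and the source.
    All three are at most the next power of the constant times the source, hence the factor 3 in
    [transfer_const]. The classes are then summed. *)
Lemma transfer_bound {R : realType} d L (i0 : 'I_d) (m : nat) (t : R) (v : lattice d L -> R[i]) :
  let g x := rc t * v x - \sum_u v (nb u x) in
  (forall x : lattice d L, (x i0 %% m.+1 < 2)%N -> v x = 0) ->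
  \sum_x sq (v x) <= m.+1%:R * transfer_const d t ^+ m.+1 * \sum_x sq (g x).
Proof.
move=> g hv; pose A := transfer_const d t; rewrite -/A.
pose mass (k : nat) := \sum_(x : lattice d L | (x i0 %% m.+1 == k)%N) sq (v x).
set K := \sum_x sq (g x).
have K0 : 0 <= K by apply: sumr_ge0 => x _; exact: sq_ge0.
have A1 : 1 <= A := transfer_const_ge1 d t.
have A0 : 0 <= A by apply: le_trans A1.
have mass01 k : (k < 2)%N -> mass k = 0.
  by move=> k2; apply: big1 => x /eqP e; rewrite hv ?sq0 // e.
have bnd k : (k < m.+1)%N -> mass k <= A ^+ k * K /\ ((k.+1 < m.+1)%N -> mass k.+1 <= A ^+ k.+1 * K).
  elim: k => [|k IH] km.
    by split=> [|_]; rewrite mass01 // mulr_ge0 // exprn_ge0.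
  have [h1 h2] := IH (ltnW km); split=> [|km2]; first exact: h2.
  apply: (le_trans (transfer_step d L i0 m.+1 k t v isT km2)).
  rewrite -/(mass k.+1) -/(mass k) -/g -/K exprS.
  have B0 : 0 <= (4 * t ^+ 2 + 8 * d%:R + 2) * (2 * d%:R + 1) :> R by move: A0; rewrite /A /transfer_const pmulr_rge0.
  have p1 : A ^+ k * K <= A ^+ k.+1 * K by rewrite ler_wpM2r // ler_weXn2l.
  have p0 : K <= A ^+ k.+1 * K by rewrite ler_peMl // exprn_ege1.
  apply: (@le_trans _ _ ((4 * t ^+ 2 + 8 * d%:R + 2) * (2 * d%:R + 1) * (3 * (A ^+ k.+1 * K)))).
    by apply: ler_wpM2l => //; move: h1 (h2 km) p1 p0 => {hv IH}; lra.
  by rewrite -[A * _ * K]mulrA; move: (A ^+ k.+1 * K) => z; rewrite /A /transfer_const [leLHS]mulrCA [leLHS]mulrA.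
have -> : \sum_x sq (v x) = \sum_(k < m.+1) mass k.
  rewrite (partition_big (fun x : lattice d L => (inord (x i0 %% m.+1) : 'I_m.+1)) predT) //=.
  apply: eq_bigr => k _; apply: eq_bigl => x.
  by rewrite -(inj_eq val_inj) /= inordK // ltn_pmod.
have -> : m.+1%:R * A ^+ m.+1 * K = \sum_(k < m.+1) A ^+ m.+1 * K.
  by rewrite sumr_const card_ord -mulrA mulr_natl.
apply: ler_sum => k _; apply: (le_trans (bnd k (ltn_ord k)).1).
by rewrite ler_wpM2r // ler_weXn2l // ltnW.
Qed.

(** Dimension count: coefficients supported on [Q] form a space of dimension |Q|, and vanishing on
    [S] imposes only |S| linear conditions. [E] embeds the coefficients and [G] restricts to [S]. *)
Lemma exists_supported_row {F : fieldType} n (V : 'M[F]_n) (Q S : pred 'I_n) : (#|S| < #|Q|)%N ->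
  exists c : 'rV[F]_n, [/\ c != 0, forall k, ~~ Q k -> c 0 k = 0 & forall i, S i -> (c *m V) 0 i = 0].
Proof.
move=> SQ.
pose E : 'M[F]_(#|Q|, n) := \matrix_(j, k) (enum_val j == k)%:R.
pose G : 'M[F]_(n, #|S|) := \matrix_(k, j) (k == enum_val j)%:R.
have EE : E *m E^T = 1%:M.
  apply/matrixP => i j; rewrite !mxE (bigD1 (enum_val i)) //= big1 => [|k /negbTE ne].
    by rewrite !mxE eqxx mul1r addr0 (inj_eq enum_val_inj) eq_sym.
  by rewrite !mxE eq_sym ne mul0r.
have : kermx (E *m V *m G) != 0.
  rewrite -mxrank_eq0 mxrank_ker -lt0n subn_gt0.
  exact: leq_ltn_trans (rank_leq_col _) SQ.
move=> /rowV0Pn [c /sub_kermxP cA c0].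
exists (c *m E); split.
- by apply: contraNneq c0 => cE; rewrite -[c]mulmx1 -EE mulmxA cE mul0mx.
- move=> k nQ; rewrite mxE big1 // => j _; rewrite mxE.
  case: eqP => [e|_]; last by rewrite mulr0.
  by have := enum_valP j; rewrite e unfold_in (negbTE nQ).
- move=> i Si; have Si' : i \in S by [].
  move: cA; rewrite !mulmxA => /matrixP /(_ 0 (enum_rank_in Si' i)).
  rewrite [RHS]mxE mxE (bigD1 i) //= big1 => [|k /negbTE ne].
    by rewrite [G _ _]mxE enum_rankK_in // eqxx mulr1 addr0.
  by rewrite [G _ _]mxE enum_rankK_in // ne mulr0.
Qed.

Lemma row_sum_sq {R : realType} {n} (V : 'M[R[i]]_n) (c : 'rV[R[i]]_n) : unitary V ->
  \sum_x sq ((c *m V) 0 x) = \sum_k sq (c 0 k).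
Proof.
move=> [_ u].
have e (w : 'rV[R[i]]_n) : \sum_x sq (w 0 x) = Re ((w *m adjmx w) 0 0).
  by rewrite mxE Re_sum; apply: eq_bigr => x _; rewrite adjmxE Re_mul_conj.
by rewrite !e adjmxM mulmxA -[c *m V *m _]mulmxA u mulmx1.
Qed.

(* If there were more eigenvalues near 0 than sites in the slabs, a combination of their
   eigenvectors would vanish on the slabs, contradicting [transfer_bound]. *)
Lemma count_near_level {R : realType} d L (i0 : 'I_d) (m : nat) (t eta : R)
    (V : 'M[R[i]]_(nsites d L)) (l : 'I_(nsites d L) -> R) :
  (2 < L)%N -> unitary V ->
  (forall i j, specf V l i j = rc (t * (i == j)%:R - (nnrel d L i j)%:R)) -> 0 < eta ->
  eta ^+ 2 * (m.+1%:R * transfer_const d t ^+ m.+1) < 1 ->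
  (#|[pred k | (`|l k| < eta)%R]| <= #|[pred x : lattice d L | (x i0 %% m.+1 < 2)%N]|)%N.
Proof.
move=> L2 u hK eta0 heta.
set C := m.+1%:R * _ in heta.
have -> : #|[pred x : lattice d L | (x i0 %% m.+1 < 2)%N]| =
    #|[pred i : 'I_(nsites d L) | (site d L i i0 %% m.+1 < 2)%N]|.
  rewrite -!sum1_card [RHS]big_mkcond [LHS]big_mkcond [RHS](reindex (@idx d L)) /=.
    by apply: eq_bigr => x _; rewrite !inE site_idx.
  by exists (site d L) => [x _|i _]; [exact: site_idx|exact: idx_site].
rewrite leqNgt; apply/negP => lt.
have [c [c0 cQ cS]] := exists_supported_row _ V _ _ lt.
pose v (x : lattice d L) := (c *m V) 0 (idx x).
have hv (x : lattice d L) : (x i0 %% m.+1 < 2)%N -> v x = 0.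
  by move=> h; apply: cS; rewrite inE site_idx.
have := transfer_bound d L i0 m t v hv; rewrite -/C.
have -> : \sum_x sq (v x) = \sum_k sq (c 0 k).
  by rewrite -(row_sum_sq V c u) sum_sites.
have eg x : rc t * v x - \sum_u0 v (nb u0 x) = ((c *m diag_mx (\row_k rc (l k))) *m V) 0 (idx x).
  have -> : c *m diag_mx (\row_k rc (l k)) *m V = c *m V *m specf V l.
    by rewrite /specf !mulmxA -[c *m V *m adjmx V]mulmxA u.2 mulmx1.
  rewrite [RHS]mxE; under [RHS]eq_bigr => i _ do rewrite hK rmorphB /= mulrBr.
  rewrite [RHS]sumrB; congr (_ - _).
    rewrite /v; move: (c *m V) => w.
    rewrite [RHS](bigD1 (idx x)) // eqxx mulr1 big1 => [|i /negbTE ne].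
      by rewrite /= addr0 mulrC.
    by rewrite ne mulr0 rmorph0 mulr0.
  rewrite -[x in LHS](site_idx _ _ x) -(sum_nnrel d L (idx x) (fun i => (c *m V) 0 i) L2).
  apply: eq_bigr => i _; rewrite nnrel_sym mulrC; congr (_ * _).
  by case: (nnrel _ _ _ _); rewrite ?rmorph1 ?rmorph0.
under [X in _ <= _ * X]eq_bigr => x _ do rewrite eg.
rewrite -(sum_sites _ d L (fun i => sq ((c *m diag_mx (\row_k rc (l k)) *m V) 0 i))) (row_sum_sq V _ u).
have c1 : 0 < \sum_k sq (c 0 k).
  rewrite lt_def sumr_ge0 ?andbT; last by move=> k _; exact: sq_ge0.
  apply: contraNneq c0 => /eqP; rewrite psumr_eq0; last by move=> k _; exact: sq_ge0.
  move=> /allP h; apply/eqP/matrixP => i k; rewrite ord1 [RHS]mxE; apply: sq_eq0.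
  by apply/eqP; apply: h; rewrite mem_index_enum.
(* All eigenvalues in the support of [c] are below [eta] in modulus, so K nearly annihilates [v];
   the transfer bound then gives |c|^2 <= C eta^2 |c|^2 with C eta^2 < 1. *)
have le1 : \sum_k sq ((c *m diag_mx (\row_k rc (l k))) 0 k) <= eta ^+ 2 * \sum_k sq (c 0 k).
  rewrite mulr_sumr; apply: ler_sum => k _.
  rewrite mul_mx_diag [X in sq X]mxE [(\row__ _) 0 k]mxE sqM sq_rc mulrC.
  have [h|h] := boolP (`|l k| < eta).
    rewrite ler_wpM2r ?sq_ge0 // -[l k ^+ 2]real_normK ?num_real //.
    by rewrite lerXn2r ?nnegrE // ltW.
  by rewrite cQ ?inE // sq0 !mulr0.
have C0 : 0 <= C.
  by rewrite mulr_ge0 ?ler0n // exprn_ge0 // (le_trans ler01) // transfer_const_ge1.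
move=> h; have := le_trans h (ler_wpM2l C0 le1).
by rewrite mulrA [C * _]mulrC leNgt gtr_pMl // heta.
Qed.

(** There are two residues in each of at most L/(m+1) + 1 blocks, the last one possibly incomplete.
    The assumption m+1 <= L absorbs that block, which turns the factor 2 into 4. *)
Lemma card_residues L m : (m.+1 <= L)%N ->
  (#|[pred a : 'I_L | (a %% m.+1 < 2)%N]| * m.+1 <= 4 * L)%N.
Proof.
move=> mL.
pose f (a : 'I_L) : 'I_(L %/ m.+1).+1 * 'I_2 := (inord (a %/ m.+1), inord (a %% m.+1)).
have le : (#|[pred a : 'I_L | (a %% m.+1 < 2)%N]| <= (L %/ m.+1).+1 * 2)%N.
  have <- : #|f @: [pred a : 'I_L | (a %% m.+1 < 2)%N]| = #|[pred a : 'I_L | (a %% m.+1 < 2)%N]|.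
    apply: card_in_imset => a b; rewrite !inE => ha hb [].
    have ab (z : 'I_L) : (z %/ m.+1 < (L %/ m.+1).+1)%N by rewrite ltnS leq_div2r // ltnW.
    move=> /(congr1 val); rewrite /= !inordK // => e1 /(congr1 val); rewrite /= !inordK // => e2.
    by apply: val_inj; rewrite /= (divn_eq a m.+1) (divn_eq b m.+1) e1 e2.
  by apply: leq_trans (max_card _) _; rewrite card_prod !card_ord.
have := leq_divM L m.+1; have := leq_mul le (leqnn m.+1).
move: (L %/ m.+1)%N #|_| => q c; nia.
Qed.

Lemma card_slab d L (i0 : 'I_d) m : (m.+1 <= L)%N ->
  (#|[pred x : lattice d L | (x i0 %% m.+1 < 2)%N]| * m.+1 <= 4 * nsites d L)%N.
Proof.
move=> mL.
have h1 := card_box d L (fun i => if i == i0 then [pred a : 'I_L | (a %% m.+1 < 2)%N] else predT).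
have h2 := card_box d L (fun=> predT).
rewrite (bigD1 i0) //= eqxx in h1; rewrite (bigD1 i0) //= card_ord in h2.
have e1 : #|[pred x : lattice d L | (x i0 %% m.+1 < 2)%N]| =
    (#|[pred a : 'I_L | (a %% m.+1 < 2)%N]| * \prod_(i < d | i != i0) L)%N.
  have <- : (\prod_(i < d | i != i0) #|if i == i0 then [pred a : 'I_L | (a %% m.+1 < 2)%N] else predT| =
      \prod_(i < d | i != i0) L)%N.
    by apply: eq_bigr => i /negbTE ->; rewrite card_ord.
  rewrite -h1; apply: eq_card => x; rewrite !inE; apply/idP/forallP => [h i|/(_ i0)].
    by case: eqP => [->|].
  by rewrite eqxx.
have e2 : nsites d L = (L * \prod_(i < d | i != i0) L)%N.
  by rewrite -h2; apply: eq_card => x; rewrite !inE; apply/esym/forallP.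
by rewrite e1 e2 mulnAC mulnA leq_mul2r card_residues // orbT.
Qed.

(** By translation invariance the local density of states equals its average, the fraction of
    eigenvalues near 0, which is at most the slab fraction 4/(m+1). *)
Lemma dos_bound {R : realType} (d : nat) (t eps : R) : (0 < d)%N -> 0 < eps ->
  exists (eta : R) (m : nat), 0 < eta /\
  forall L (V : 'M[R[i]]_(nsites d L)) l, (2 < L)%N -> (m <= L)%N -> unitary V ->
    (forall i j, specf V l i j = rc (t * (i == j)%:R - (nnrel d L i j)%:R)) ->
    forall y, \sum_(k | `|l k| < eta) sq (V k y) <= eps.
Proof.
move=> d0 eps0; pose i0 := Ordinal d0.
pose m := Num.bound (4 / eps).
have hm : 4 / eps < m%:R by apply: archi_boundP; rewrite divr_ge0 // ltW.
pose C : R := m.+1%:R * transfer_const d t ^+ m.+1.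
have C0 : 0 <= C.
  by rewrite mulr_ge0 ?ler0n // exprn_ge0 // (le_trans ler01) // transfer_const_ge1.
have C1 : 0 < C + 1 by rewrite ltr_wpDl.
(* This choice of [eta] satisfies eta^2 C < 1, as the eigenvalue count demands. *)
exists (C + 1)^-1, m.+1; split; first by rewrite invr_gt0.
move=> L V l L2 mL u hK y.
have heta : (C + 1)^-1 ^+ 2 * C < 1.
  rewrite exprVn ltr_pdivrMl ?exprn_gt0 // mulr1 expr2.
  by have := mulr_ge0 C0 C0; move: C0 => {C1 hm mL}; move: C => c c0 cc; lra.
have cnt := count_near_level d L i0 m t (C + 1)^-1 V l L2 u hK (ltac:(by rewrite invr_gt0)) heta.
have slab := card_slab d L i0 m mL.
set Q := fun k => `|l k| < (C + 1)^-1 in cnt *.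
have GE x : \sum_(k | Q k) sq (V k x) = Re (specf V (fun k => (Q k)%:R) x x).
  rewrite specf_diag big_mkcond; apply: eq_bigr => k _; by case: (Q k); rewrite ?mul1r ?mul0r.
have Gc x : \sum_(k | Q k) sq (V k x) = \sum_(k | Q k) sq (V k y).
  rewrite !GE; congr Re.
  exact: (specf_diag_const d L V l t (fun z => (`|z| < (C + 1)^-1)%R%:R)).
have tot : (nsites d L)%:R * (\sum_(k | Q k) sq (V k y)) = #|[pred k | Q k]|%:R.
  transitivity (\sum_(x < nsites d L) \sum_(k | Q k) sq (V k x)).
    by under [RHS]eq_bigr do rewrite Gc; rewrite sumr_const card_ord mulr_natl.
  rewrite exchange_big /= (eq_bigr (fun=> 1)) => [|k _]; last exact: sum_sq_unitary_row.
  by rewrite sumr_const.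
have n0 : 0 < (nsites d L)%:R :> R by rewrite ltr0n; apply: leq_ltn_trans (ltn_ord y).
rewrite -(ler_pM2l n0) tot.
have h : (#|[pred k | Q k]| * m.+1 <= 4 * nsites d L)%N.
  by apply: leq_trans slab; rewrite leq_mul2r cnt orbT.
move: h; rewrite -(ler_nat R) !natrM => h.
have m1 : 0 < m.+1%:R :> R by rewrite ltr0n.
rewrite -(ler_pM2r m1); apply: (le_trans h).
rewrite mulrC -mulrA ler_pM2l //.
have : 4 < m.+1%:R * eps by rewrite -ltr_pdivrMr //; apply: lt_trans hm _; rewrite ltr_nat.
by rewrite mulrC => /ltW.
Qed.

(** * The theorem *)

(** The rows of [V] with [a k < mu] lie in the eigenspaces being summed. Conversely, a left
    eigenvector for [r] has eigenbasis coefficients only where [a k = r], so for [r < mu] the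
    projection fixes it. *)
Lemma negproj_spectral {R : realType} d L (mu : R) (V : 'M[R[i]]_(nsites d L)) a : unitary V ->
  cplx (- laplacian R d L) = specf V a ->
  spectral_proj_below d L mu (negproj V (fun k => a k - mu)).
Proof.
move=> u eA; split; first exact: specf_herm.
split; first exact: negproj_idem.
rewrite /low_spectral_subspace eA.
have eigV k : (row k V <= eigenspace (specf V a) (rc (a k)))%MS.
  apply/eigenspaceP; rewrite -row_mul; apply/rowP => x.
  by rewrite [LHS]mxE (specf_mulV V a k x u) [RHS]mxE [X in _ = _ * X]mxE.
apply/andP; split.
  rewrite /negproj /specf -mulmxA; apply: submx_trans (submxMl _ _) _.
  apply/row_subP => k.
  have -> : row k (diag_mx (\row_j rc (a j - mu < 0)%R%:R) *m V) = rc (a k - mu < 0)%R%:R *: row k V.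
    by apply/rowP => x; rewrite [LHS]mxE mul_diag_mx [LHS]mxE [X in X * _ = _]mxE [RHS]mxE [X in _ = _ * X]mxE.
  case: ltP => [lk|_]; last by rewrite rmorph0 scale0r sub0mx.
  rewrite rmorph1 scale1r (big_rem (a k)) /=; last exact: mem_rootsR_specf u eA.
  rewrite -subr_lt0 lk; apply: submx_trans (eigV k) _; exact: addsmxSl.
apply: (big_ind (fun X : 'M_(nsites d L) => (X <= negproj V (fun k => (a k - mu)%R))%MS)).
- exact: sub0mx.
- by move=> X Y hX hY; rewrite addsmx_sub hX hY.
move=> r rmu; set v := eigenspace _ _.
have /eigenspaceP ev : (v <= v)%MS by exact: submx_refl.
suff <- : v *m negproj V (fun k => a k - mu) = v by exact: submxMl.
pose W := v *m adjmx V.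
have eW i k : W i k * rc (a k) = rc r * W i k.
  have : W *m diag_mx (\row_k rc (a k)) = rc r *: W.
    rewrite /W scalemxAl -ev /specf !mulmxA -[_ *m V *m adjmx V]mulmxA u.2 mulmx1 //.
  by rewrite mul_mx_diag => /matrixP /(_ i k); rewrite [LHS]mxE [X in _ * X]mxE [RHS]mxE.
have WP : W *m diag_mx (\row_k rc (a k - mu < 0)%R%:R) = W.
  apply/matrixP => i k; rewrite mul_mx_diag [LHS]mxE [X in _ * X]mxE.
  have [->|Wn] := eqVneq (W i k) 0; first by rewrite mul0r.
  have er : a k = r by move: (eW i k); rewrite [RHS]mulrC => /(mulfI Wn) [].
  by rewrite er subr_lt0 rmu rmorph1 mulr1.
rewrite /negproj /specf !mulmxA -/W WP /W -mulmxA u.1 mulmx1 //.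
Qed.

Lemma hfz_energyE {R : realType} d L (mu U : R) (gu gd : 'M[R[i]]_(nsites d L)) :
  Defs.hermitian gu -> Defs.hermitian gd ->
  hfz_energy d L mu U gu gd =
  Re (\tr (cplx (Kmu R d L mu) *m (gu + gd))) + U * (\sum_x Re (gu x x) * Re (gd x x)).
Proof.
move=> hu hd; rewrite /hfz_energy ReD ReZ; congr (_ + _ * _).
rewrite Re_sum; apply: eq_bigr => x _.
have Im0 (g : 'M[R[i]]_(nsites d L)) : Defs.hermitian g -> Im (g x x) = 0.
  by move=> h; have := herm_entry g x x h; case: (g x x) => p q [] /= e; lra.
by move: (Im0 _ hu) (Im0 _ hd); case: (gu x x) => p q; case: (gd x x) => p' q' /= -> ->; rewrite mul0r subr0.
Qed.

(** Connectedness of the lattice in the form of shift invariance: closure along the symmetric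
    relation makes [A] invariant under every unit shift. *)
Lemma colour_const d L (A : pred 'I_(nsites d L)) : (2 < L)%N ->
  (forall x y, nnrel d L x y -> A x -> A y) -> forall i j, A i = A j.
Proof.
move=> L2 hA i j; rewrite -(idx_site _ _ i) -(idx_site _ _ j).
apply: (shift_invariant_const _ _ _ (fun x => A (idx x))) => k x.
have T : nnrel d L (idx x) (idx (nb (true, k) x)) by rewrite /nnrel !site_idx l1dist_nb.
by apply/idP/idP; apply: hA; rewrite // nnrel_sym.
Qed.

Theorem theorem1p1 (R : realType) (d : nat) (mu : R) :
  (1 <= d)%N -> 0 < mu -> mu < (4 * d)%:R ->
  exists (Lsharp : nat) (Usharp : R), 0 <= Usharp /\
    forall (L : nat) (U : R), ~~ odd L -> (Lsharp <= L)%N -> Usharp <= U ->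
      hfz_min_energy d L mu U = trace_neg (Kmu R d L mu) /\
      (~~ eigenvalue (- laplacian R d L) mu ->
       forall gu gd : 'M[R[i]]_(nsites d L),
         density_matrix gu -> density_matrix gd ->
         hfz_energy d L mu U gu gd = hfz_min_energy d L mu U ->
         (spectral_proj_below d L mu gu /\ gd = 0) \/
         (gu = 0 /\ spectral_proj_below d L mu gd)).
Proof.
move=> d0 mu0 mu4.
pose t : R := (2 * d)%:R - mu; pose q : R := (2 * d)%:R.
have q0 : 0 < q by rewrite ltr0n muln_gt0.
have ht : `|t| < q.
  have e4 : (4 * d)%:R = 2 * q :> R by rewrite /q -natrM mulnA.
  by rewrite ltr_norml; apply/andP; split; rewrite /t -/q; move: mu4; rewrite {}e4; move: q q0 => z z0; lra.
have [p [m0 [p0 p1 hp]]] := negproj_edge_lower_bound d t d0 ht.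
have eps0 : 0 < p ^+ 4 / 160 by rewrite divr_gt0 // exprn_gt0.
(* The value is p^4/8 divided by 20, where 20 is twice the column bound 10. *)
have [eta [m1 [eta0 hdos]]] := dos_bound d t (p ^+ 4 / 160) d0 eps0.
have c0 : 0 < `|t| + q by rewrite ltr_wpDl.
have heps : 20 * (p ^+ 4 / 160) <= p ^+ 4 / 8 by move: (p ^+ 4) => z; lra.
have [W0 [W00 hW0]] := energy_dichotomy t q (`|t| + q) p eta (p ^+ 4 / 160) q0 c0 p0 p1 eta0 heps.
exists (maxn 3 (maxn m0 m1)), W0; split=> // L U eL; rewrite !geq_max => /and3P[L2 Lm0 Lm1] hU.
have symlap : (- laplacian R d L)^T = - laplacian R d L.
  by apply/matrixP => i j; rewrite !mxE l1distC [j == i]eq_sym.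
have [V [a [u eA]]] := exists_specf _ symlap.
pose l k := a k - mu.
have eK : cplx (Kmu R d L mu) = specf V l.
  have -> : specf V l = specf V a + specf V (fun=> - mu) by rewrite specfD.
  rewrite (specf_cst V (- mu) u) -eA; apply/matrixP => i j; rewrite !mxE.
  by case: (i == j); rewrite ?mulr1n ?mulr0n ?subr0 ?addr0 // [LHS]rmorphD.
have hK i j : specf V l i j = rc (t * (i == j)%:R - (nnrel d L i j)%:R) by rewrite -eK Kmu_entry.
have lc k : `|l k| <= `|t| + q.
  exact: (eigenvalue_bound V l (nnrel d L) t q k u hK (nnrel_sym d L) (fun x => nnrel_degree d L x L2)).
have edge := hp L V l eL L2 Lm0 u hK.
have dP := negproj_density V l u.
(* The diagonal bound follows from the edge bound: p^2 <= |P_yx|^2 <= P_xx for a neighbour y. *)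
have diagP x : p ^+ 2 <= Re (negproj V l x x).
  pose y := idx (nb (true, Ordinal d0) (site d L x)).
  have Tyx : nnrel d L y x by rewrite nnrel_sym /nnrel site_idx l1dist_nb.
  apply: le_trans (density_entry_bound _ x y dP); apply: le_trans (Re_sq _).
  by rewrite lerXn2r ?nnegrE ?(ltW p0) ?edge // (le_trans (ltW p0)) // edge.
have main gu gd := hW0 U hU (nsites d L) V l (nnrel d L) gu gd u hK lc (nnrel_sym d L)
  (fun x => nnrel_degree d L x L2) diagP edge (hdos L V l L2 Lm1 u hK).
have tn : trace_neg (Kmu R d L mu) = \sum_(k | l k < 0) l k by exact: trace_neg_specf u eK.
have enE (gu gd : 'M[R[i]]_(nsites d L)) : density_matrix gu -> density_matrix gd ->
    hfz_energy d L mu U gu gd = Re (\tr (specf V l *m (gu + gd))) + U * (\sum_x Re (gu x x) * Re (gd x x)).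
  by move=> du dd; rewrite (hfz_energyE d L mu U gu gd du.1.1 dd.1.1) eK.
have trP : Re (\tr (specf V l *m negproj V l)) = \sum_(k | l k < 0) l k.
  rewrite tr_specf [RHS]big_mkcond; apply: eq_bigr => k _; rewrite wt_specf //.
  by case: ifP => _; rewrite ?mulr1 ?mulr0.
have minE : hfz_min_energy d L mu U = \sum_(k | l k < 0) l k.
  pose S : classical_sets.set R := [set e | exists gu gd : 'M[R[i]]_(nsites d L),
    density_matrix gu /\ density_matrix gd /\ e = hfz_energy d L mu U gu gd]%classic.
  have attained : S (\sum_(k | l k < 0) l k).
    exists (negproj V l), 0; split; first exact: dP.
    split; first exact: density0.
    rewrite (enE _ _ dP density0) addr0 trP [X in _ + U * X]big1 ?mulr0 ?addr0 // => x _.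
    by rewrite [(0 : 'M_ _) x x]mxE /= mulr0.
  (* This also shows that [S] is bounded below, as needed to compare [inf] with the attained
     value. *)
  have lb : lbound S (\sum_(k | l k < 0) l k).
    by move=> _ [gu [gd [du [dd ->]]]]; rewrite enE //; exact: (main gu gd du dd).1.
  apply/eqP; rewrite eq_le; apply/andP; split.
    by apply: ge_inf => //; exists (\sum_(k | l k < 0) l k).
  by apply: lb_le_inf => //; exists (\sum_(k | l k < 0) l k).
split; first by rewrite minE tn.
move=> nev gu gd du dd; rewrite minE enE // => e.
(* A zero mode of K could be occupied at no kinetic cost; its absence makes the single-spin
   minimizer unique. *)
have l0 k : l k != 0.
  apply: contra nev => /eqP lk; rewrite eigenvalue_root_char (char_poly_specf V _ a u eA).
  by rewrite (bigD1 k) //= rootM root_XsubC -[mu]add0r -lk /l subrK eqxx.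
have uniq (g : 'M[R[i]]_(nsites d L)) : density_matrix g ->
    Re (\tr (specf V l *m g)) = \sum_(k | l k < 0) l k -> spectral_proj_below d L mu g.
  by move=> dg /(density_minimizer_unique V l g u l0 dg) ->; exact: negproj_spectral.
have [A [hA hu hd]] := (main gu gd du dd).2 e.
have Ac := colour_const d L A L2 hA.
case: (boolP [exists x, A x]) => [/existsP[x Ax]|/existsPn nA].
  left; have gd0 : gd = 0 by apply: density_diag0 => // y; apply: hd; rewrite (Ac y x).
  split=> //; apply: uniq => //; rewrite -e gd0 addr0 [X in _ + U * X]big1 ?mulr0 ?addr0 // => y _.
  by rewrite [(0 : 'M_ _) y y]mxE /= mulr0.
right; have gu0 : gu = 0.
  by apply: density_diag0 => // y; exact: hu (nA y).
split=> //; apply: uniq => //; rewrite -e gu0 add0r [X in _ + U * X]big1 ?mulr0 ?addr0 // => y _.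
by rewrite [(0 : 'M_ _) y y]mxE /= mul0r.
Qed.
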